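(* Let $(B,\Phi_B,H,\ell)$ be a cocommutative augmented rack bialgebra over $K$ (with action written $h.b=\ell(h\otimes b)$). Then the $K$-module $B\otimes H$, with coalgebra structure $(\Delta_{B\otimes H},\epsilon_B\otimes\epsilon_H,\mathbf{1}_B\otimes\mathbf{1}_H)$, is an augmented cocommutative Hopf dialgebra $(B\otimes H,\Delta_{B\otimes H},\epsilon_B\otimes\epsilon_H,\mathbf{1}_B\otimes\mathbf{1}_H,\Phi,H)$ by means of the following definitions (for $h,h'\in H$, $b\in B$): 1. $\Phi:B\otimes H\to H$, $\Phi(b\otimes h):=\Phi_B(b)h$; 2. the $H$-bimodule structure $h'.(b\otimes h):=\sum_{(h')}((h')^{(1)}.b)\otimes((h')^{(2)}h)$ and $(b\otimes h).h':=b\otimes(hh')$; 3. the antipode $S(b\otimes h):=\mathbf{1}_B\otimes S_H\big(\Phi_B(b)h\big)$; where the two multiplications are $X\vdash Y:=\Phi(X).Y$ and $X\dashv Y:=X.\Phi(Y)$. Moreover, the Leibniz bracket $[X,Y]=X\vdash Y-Y\dashv X$ on the $K$-module of all primitive elements of $B\otimes H$, $\mathfrak{a}:=\mathsf{Prim}(B)\oplus\mathsf{Prim}(H)$, is computed as follows for all $x,y\in\mathsf{Prim}(B)$ and $\xi,\eta\in\mathsf{Prim}(H)$ (writing $x$ and $\xi$ for $x\otimes\mathbf{1}_H$ and $\mathbf{1}_B\otimes\xi$): $$[x+\xi,y+\eta]=\big([x,y]+\xi.y\big)+\big([\Phi_B(x),\eta]+[\xi,\eta]\big).$$ This Leibniz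 algebra is split over the Lie subalgebra $\mathsf{Prim}(H)$: $\mathfrak{a}$ is the direct sum of $\mathsf{Prim}(H)$ and the two-sided ideal $\{x-\Phi_B(x) : x\in\mathsf{Prim}(B)\}$, and this ideal is contained in the left center $\{z\in\mathfrak{a}: [z,w]=0\ \forall w\in\mathfrak{a}\}$ of $\mathfrak{a}$.
   Context: $K$ is an associative commutative unital ring containing $\mathbb{Q}$, $\otimes=\otimes_K$. A $C^3$-coalgebra is a $K$-module $C$ with coassociative comultiplication $\Delta$, counit $\epsilon$, and an element $\mathbf{1}$ with $\Delta(\mathbf{1})=\mathbf{1}\otimes\mathbf{1}$, $\epsilon(\mathbf{1})=1$; morphisms of $C^3$-coalgebras are $K$-linear maps respecting $\Delta,\epsilon,\mathbf{1}$. Tensor products of $C^3$-coalgebras carry the usual structure. $\mathsf{Prim}(C)=\{x:\Delta(x)=x\otimes\mathbf{1}+\mathbf{1}\otimes x\}$. Sweedler notation is used. Augmented rack bialgebra $(B,\Phi_B,H,\ell)$: $B$ is a $C^3$-coalgebra, $H$ is a cocommutative Hopf algebra with antipode $S_H$, $\Phi_B:B\to H$ is a morphism of $C^3$-coalgebras, and $\ell:H\otimes B\to B$ is a left $H$-module structure on $B$ which is a morphism of $C^3$-coalgebras, such that for all $h\in H$, $a\in B$: $h.\mathbf{1}_B=\epsilon_H(h)\mathbf{1}_B$ and $\Phi_B(h.a)=\mathrm{ad}_h(\Phi_B(a))$, where $\mathrm{ad}_h(h')=\sum_{(h)}h^{(1)}h'S_H(h^{(2)})$. It is cocommutative if $B$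 is cocommutative. One writes $a\triangleright b:=\Phi_B(a).b$ for $a,b\in B$; on $\mathsf{Prim}(B)$ the bracket is $[x,y]=x\triangleright y$, and on $\mathsf{Prim}(H)$ the bracket is the commutator. A dialgebra is a $K$-module $D$ with two associative bilinear multiplications $\vdash,\dashv$ satisfying $(a\vdash b)\vdash c=(a\dashv b)\vdash c$, $a\dashv(b\dashv c)=a\dashv(b\vdash c)$, $(a\vdash b)\dashv c=a\vdash(b\dashv c)$. A bar-unit is an element $\mathbf{1}$ with $\mathbf{1}\vdash a=a=a\dashv\mathbf{1}$ for all $a$; a bar-unital dialgebra is balanced if $a\vdash\mathbf{1}=\mathbf{1}\dashv a$ for all $a$. An augmented dialgebra $(A,\Phi,H)$ consists of a unital associative algebra $H$, an $H$-bimodule $A$ and an $H$-bimodule map $\Phi:A\to H$; it is a dialgebra via $x\vdash y=\Phi(x)y$, $x\dashv y=x\Phi(y)$. A cocommutative Hopf dialgebra $(A,\Delta,\epsilon,\mathbf{1},\vdash,\dashv,S)$ is a cocommutative $C^3$-coalgebra $(A,\Delta,\epsilon,\mathbf{1})$ such that $(A,\mathbf{1},\vdash,\dashv)$ is a bar-unital balanced dialgebra, $\vdash$ and $\dashv$ are morphisms of $C^3$-coalgebras $A\otimes A\to A$, and $S:A\to A$ is a morphism of $C^3$-coalgebras with $\sum_{(a)}a^{(1)}\vdash S(a^{(2)})=\epsilon(a)\mathbf{1}=\sum_{(a)}S(a^{(1)})\dashv a^{(2)}$ for all $a$. A cocommutative Hopf dialgebra is called augmented when its multiplications come from an augmented dialgebra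 structure. A (left) Leibniz algebra is a $K$-module with bilinear bracket satisfying $[x,[y,z]]=[[x,y],z]+[y,[x,z]]$. *)

(* Defs.v *)
From HB Require Import structures.
From mathcomp Require Import all_boot all_order all_algebra generic_quotient.
From mathcomp Require Import boolp classical_sets functions.

Set Implicit Arguments.
Unset Strict Implicit.
Unset Printing Implicit Defensive.

Import GRing.Theory.

Local Open Scope quotient_scope.
Local Open Scope ring_scope.

Local Notation bilinear f := (bilinear_for *:%R *:%R f).

(** The tensor product [tensor M N] of modules over a commutative ring is given by generators and relations: finite lists of pairs,
    read as sums of elementary tensors, modulo the congruence [teq]. *)

Section TensorDef.
Variables (K : comNzRingType) (M N : lmodType K).
Implicit Types (s t : seq (M * N)) (x : M) (y : N) (a : K).

Inductive teq : seq (M * N) -> seq (M * N) -> Prop :=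
| teq_refl s : teq s s
| teq_sym s t : teq s t -> teq t s
| teq_trans s t u : teq s t -> teq t u -> teq s u
| teq_cat s s' t t' : teq s s' -> teq t t' -> teq (s ++ t) (s' ++ t')
| teq_catC s t : teq (s ++ t) (t ++ s)
| teq_Dl x x' y : teq [:: (x + x', y)] [:: (x, y); (x', y)]
| teq_Dr x y y' : teq [:: (x, y + y')] [:: (x, y); (x, y')]
| teq_Z a x y : teq [:: (a *: x, y)] [:: (x, a *: y)]
| teq_0 y : teq [:: (0, y)] [::].

Definition teqb s t : bool := `[< teq s t >].

Lemma teqb_refl : reflexive teqb.
Proof. by move=> s; apply/asboolP/teq_refl. Qed.

Lemma teqb_sym : symmetric teqb.
Proof. by move=> s t; apply/asboolP/asboolP => /teq_sym. Qed.

Lemma teqb_trans : transitive teqb.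
Proof.
move=> t s u /asboolP st /asboolP tu.
by apply/asboolP/(teq_trans st tu).
Qed.

Canonical teq_equiv := EquivRel teqb teqb_refl teqb_sym teqb_trans.

Definition tensor := {eq_quot teq_equiv}.
HB.instance Definition _ := Choice.on tensor.
HB.instance Definition _ := EqQuotient.on tensor.

Lemma tensor_eqP s t : \pi_tensor s = \pi_tensor t <-> teq s t.
Proof.
split; first by move/eqquotP/asboolP.
by move=> st; apply/eqquotP/asboolP.
Qed.

Lemma tensor_reprK (t : tensor) : \pi_tensor (repr t) = t.
Proof. exact: reprK. Qed.

Lemma teq_repr s : teq (repr (\pi_tensor s)) s.
Proof. by apply/tensor_eqP; rewrite tensor_reprK. Qed.

Definition scale_pairs a s := [seq (a *: p.1, p.2) | p <- s].

Lemma teq_scale a s t : teq s t -> teq (scale_pairs a s) (scale_pairs a t).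
Proof.
elim=> {s t} /=.
- by move=> s; apply: teq_refl.
- by move=> s t _; apply: teq_sym.
- by move=> s t u _ st _; apply: teq_trans.
- move=> s s' t t' _ ss' _ tt'; rewrite /scale_pairs !map_cat.
  exact: teq_cat.
- by move=> s t; rewrite /scale_pairs !map_cat; apply: teq_catC.
- by move=> x x' y; rewrite scalerDr; apply: teq_Dl.
- by move=> x y y'; apply: teq_Dr.
- move=> b x y; rewrite scalerA mulrC -scalerA; exact: teq_Z.
- by move=> y; rewrite scaler0; apply: teq_0.
Qed.

Definition tadd (s t : tensor) : tensor := \pi_tensor (repr s ++ repr t).
Definition tscale a (s : tensor) : tensor := \pi_tensor (scale_pairs a (repr s)).
Definition topp (s : tensor) : tensor := tscale (-1) s.
Definition tzero : tensor := \pi_tensor [::].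

Lemma tadd_pi s t : tadd (\pi_tensor s) (\pi_tensor t) = \pi_tensor (s ++ t).
Proof. by apply/tensor_eqP/teq_cat; apply: teq_repr. Qed.

Lemma tscale_pi a s : tscale a (\pi_tensor s) = \pi_tensor (scale_pairs a s).
Proof. by apply/tensor_eqP/teq_scale/teq_repr. Qed.

Lemma taddA : associative tadd.
Proof.
move=> s t u; rewrite -[s]tensor_reprK -[t]tensor_reprK -[u]tensor_reprK.
by rewrite !tadd_pi catA.
Qed.

Lemma taddC : commutative tadd.
Proof. by move=> s t; apply/tensor_eqP/teq_catC. Qed.

Lemma tadd0 : left_id tzero tadd.
Proof. by move=> s; rewrite -[s]tensor_reprK tadd_pi. Qed.

Lemma tscaleDl_pairs a b s :
  teq (scale_pairs (a + b) s) (scale_pairs a s ++ scale_pairs b s).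
Proof.
elim: s => [|[x y] s IH] /=; first exact: teq_refl.
apply: (teq_trans (t := [:: (a *: x, y); (b *: x, y)] ++
  (scale_pairs a s ++ scale_pairs b s))).
  by rewrite scalerDl; apply: (teq_cat (s := [:: _]) (teq_Dl _ _ _) IH).
apply: (teq_cat (s := [:: _]) (s' := [:: _])); first exact: teq_refl.
rewrite -(cat1s (b *: x, y) (scale_pairs b s)) !catA.
apply: (teq_cat (s := [:: _] ++ _)); first exact: teq_catC.
exact: teq_refl.
Qed.

Lemma tscale0_pairs s : teq (scale_pairs 0 s) [::].
Proof.
elim: s => [|[x y] s IH] /=; first exact: teq_refl.
by rewrite scale0r; apply: (teq_cat (s := [:: _]) (teq_0 y) IH).
Qed.

Lemma tscaleDl (s : tensor) a b :
  tscale (a + b) s = tadd (tscale a s) (tscale b s).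
Proof.
rewrite -[s]tensor_reprK !tscale_pi tadd_pi.
by apply/tensor_eqP/tscaleDl_pairs.
Qed.

Lemma tscale1 : left_id 1 tscale.
Proof.
move=> s; rewrite -[in RHS](tensor_reprK s); congr (\pi _).
by rewrite /scale_pairs -[RHS]map_id; apply: eq_map => -[x y]; rewrite scale1r.
Qed.

Lemma taddN : left_inverse tzero topp tadd.
Proof.
move=> s; rewrite /topp -[X in tadd _ X]tscale1 -tscaleDl addNr.
rewrite -[s]tensor_reprK tscale_pi.
by apply/tensor_eqP/tscale0_pairs.
Qed.

HB.instance Definition _ := GRing.isZmodule.Build tensor taddA taddC tadd0 taddN.

Lemma tscaleA a b (s : tensor) : tscale a (tscale b s) = tscale (a * b) s.
Proof.
rewrite -[s]tensor_reprK !tscale_pi; congr (\pi _).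
rewrite /scale_pairs -map_comp.
by apply: eq_map => -[x y] /=; rewrite scalerA.
Qed.

Lemma tscaleDr : right_distributive tscale +%R.
Proof.
move=> a s t; rewrite -[s]tensor_reprK -[t]tensor_reprK.
by rewrite [X in tscale a X]tadd_pi [RHS]tadd_pi tscale_pi /scale_pairs map_cat;
  apply/tensor_eqP/teq_cat; apply/teq_sym; apply: (teq_scale _ (teq_repr _)).
Qed.

HB.instance Definition _ :=
  GRing.Zmodule_isLmodule.Build K tensor tscaleA tscale1 tscaleDr tscaleDl.

Definition pure x y : tensor := \pi_tensor [:: (x, y)].

(** Sweedler-style sum: if [t] is represented by [\sum_i pure (x i) (y i)], then
    [tsum f t = \sum_i f (x i) (y i)].  The chosen representative is irrelevant
    as soon as [f] is bilinear (lemmas [tsum_linear] and [tsum_pure]), so that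
    [tsum f] is the linear map induced by [f]. *)
Definition tsum (V : nmodType) (f : M -> N -> V) (t : tensor) : V :=
  \sum_(p <- repr t) f p.1 p.2.

Lemma pure_bilinear : bilinear pure.
Proof.
have Dl x x' y : pure (x + x') y = pure x y + pure x' y.
  by rewrite [RHS]tadd_pi; apply/tensor_eqP/teq_Dl.
have Dr x y y' : pure x (y + y') = pure x y + pure x y'.
  by rewrite [RHS]tadd_pi; apply/tensor_eqP/teq_Dr.
have Zl a x y : pure (a *: x) y = a *: pure x y.
  by rewrite [RHS]tscale_pi.
have Zr a x y : pure x (a *: y) = a *: pure x y.
  by rewrite -Zl; apply/tensor_eqP/teq_sym/teq_Z.
by split=> [y a x x'|x a y y']; rewrite ?Dl ?Zl ?Dr ?Zr.
Qed.

Lemma tensor_sum_pure (t : tensor) : t = \sum_(p <- repr t) pure p.1 p.2.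
Proof.
rewrite -[LHS]tensor_reprK; elim: (repr t) => [|[x y] s IH].
  by rewrite big_nil.
by rewrite big_cons -IH [RHS]tadd_pi.
Qed.

Section Universal.
Variables (V : lmodType K) (f : M -> N -> V).
Hypothesis fL : bilinear f.

Let fDl x x' y : f (x + x') y = f x y + f x' y.
Proof. by have /= := fL.1 y 1 x x'; rewrite !scale1r. Qed.
Let fDr x y y' : f x (y + y') = f x y + f x y'.
Proof. by have /= := fL.2 x 1 y y'; rewrite !scale1r. Qed.
Let f0l y : f 0 y = 0.
Proof. by apply: (addIr (f 0 y)); rewrite add0r -fDl addr0. Qed.
Let f0r x : f x 0 = 0.
Proof. by apply: (addIr (f x 0)); rewrite add0r -fDr addr0. Qed.
Let fZl a x y : f (a *: x) y = a *: f x y.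
Proof. by have /= := fL.1 y a x 0; rewrite f0l !addr0. Qed.
Let fZr a x y : f x (a *: y) = a *: f x y.
Proof. by have /= := fL.2 x a y 0; rewrite f0r !addr0. Qed.

Let ev s := \sum_(p <- s) f p.1 p.2.

Let ev_teq s t : teq s t -> ev s = ev t.
Proof.
rewrite /ev; elim=> {s t} //=.
- by move=> s t u _ -> _ ->.
- by move=> s s' t t' _ ss' _ tt'; rewrite !big_cat ss' tt'.
- by move=> s t; rewrite !big_cat /= addrC.
- by move=> x x' y; rewrite !big_cons !big_nil /= fDl !addr0.
- by move=> x y y'; rewrite !big_cons !big_nil /= fDr !addr0.
- by move=> a x y; rewrite !big_cons !big_nil /= fZl fZr.
- by move=> y; rewrite !big_cons !big_nil /= f0l addr0.
Qed.

Let tsum_pi s : tsum f (\pi_tensor s) = ev s.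
Proof. exact: (ev_teq (teq_repr s)). Qed.

Lemma tsum_pure x y : tsum f (pure x y) = f x y.
Proof. by rewrite tsum_pi /ev big_seq1. Qed.

Lemma tsum_linear : linear (tsum f).
Proof.
move=> a s t; rewrite -[s]tensor_reprK -[t]tensor_reprK.
rewrite [a *: _]tscale_pi [_ + _]tadd_pi !tsum_pi /ev big_cat /=.
congr (_ + _); rewrite big_map scaler_sumr; apply: eq_bigr => p _.
exact: fZl.
Qed.

Lemma tsum_unique (g : tensor -> V) :
  linear g -> (forall x y, g (pure x y) = f x y) -> g =1 tsum f.
Proof.
move=> gL gp t; rewrite [in LHS](tensor_sum_pure t) /tsum.
have gD u v : g (u + v) = g u + g v by have := gL 1 u v; rewrite !scale1r.
have g0 : g 0 = 0 by apply: (addIr (g 0)); rewrite add0r -gD addr0.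
by rewrite (big_morph g gD g0); apply: eq_bigr => p _; apply: gp.
Qed.
End Universal.

End TensorDef.

Notation "x '\ox' y" := (pure x y) (at level 40, left associativity) : ring_scope.
Notation "'\tsum_' ( x , y <- t ) F" := (tsum (fun x y => F) t)
  (at level 36, x name, y name, t at level 69, F at level 36,
   format "'\tsum_' ( x ,  y  <-  t )  F") : ring_scope.

Section Structures.
Variable K : comNzRingType.

Definition tensor_map (M N M' N' : lmodType K) (f : M -> M') (g : N -> N')
    (t : tensor M N) : tensor M' N' :=
  \tsum_(x, y <- t) (f x \ox g y).

Definition tensor_assoc (M N P : lmodType K) (t : tensor (tensor M N) P) :
    tensor M (tensor N P) :=
  \tsum_(u, z <- t) (\tsum_(x, y <- u) (x \ox (y \ox z))).

Definition tensor_swap (M N : lmodType K) (t : tensor M N) : tensor N M :=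
  \tsum_(x, y <- t) (y \ox x).

(* Data of a C^3-coalgebra (coassociative, counital, coaugmented); [cone] is the
   distinguished group-like element.  The axioms are in [is_c3coalgebra]. *)
Record c3struct (C : lmodType K) := C3Struct {
  comul : C -> tensor C C;
  counit : C -> K;
  cone : C
}.

Record is_c3coalgebra (C : lmodType K) (c : c3struct C) : Prop := {
  comul_linear : linear (comul c);
  counit_linear : scalar (counit c);
  comulA : forall x, tensor_assoc (tensor_map (comul c) id (comul c x)) =
                     tensor_map id (comul c) (comul c x);
  counitl : forall x, \tsum_(x1, x2 <- comul c x) (counit c x1 *: x2) = x;
  counitr : forall x, \tsum_(x1, x2 <- comul c x) (counit c x2 *: x1) = x;
  comul_cone : comul c (cone c) = cone c \ox cone c;
  counit_cone : counit c (cone c) = 1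
}.

Definition cocommutative (C : lmodType K) (c : c3struct C) : Prop :=
  forall x, tensor_swap (comul c x) = comul c x.

Record is_c3morphism (C D : lmodType K) (c : c3struct C) (d : c3struct D)
    (f : C -> D) : Prop := {
  c3mor_linear : linear f;
  c3mor_comul : forall x, comul d (f x) = tensor_map f f (comul c x);
  c3mor_counit : forall x, counit d (f x) = counit c x;
  c3mor_cone : f (cone c) = cone d
}.

Definition tensor_c3 (C D : lmodType K) (c : c3struct C) (d : c3struct D) :
    c3struct (tensor C D) := {|
  comul := fun t => \tsum_(x, y <- t)
    \tsum_(x1, x2 <- comul c x) \tsum_(y1, y2 <- comul d y)
      ((x1 \ox y1) \ox (x2 \ox y2));
  counit := fun t => \tsum_(x, y <- t) (counit c x * counit d y);
  cone := cone c \ox cone d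
|}.

Definition Prim (C : lmodType K) (c : c3struct C) : set C :=
  [set x | comul c x = x \ox cone c + cone c \ox x]%classic.

(* An [algType] is nontrivial; this is no restriction, since
   [counit 1 = 1 <> 0] in the nontrivial ring [K]. *)
Record is_hopf_algebra (H : algType K) (c : c3struct H) (S : H -> H) : Prop := {
  hopf_c3 : is_c3coalgebra c;
  hopf_cone : cone c = 1;
  hopf_comulM : forall g h, comul c (g * h) =
    \tsum_(g1, g2 <- comul c g) \tsum_(h1, h2 <- comul c h)
      ((g1 * h1) \ox (g2 * h2));
  hopf_counitM : forall g h, counit c (g * h) = counit c g * counit c h;
  antipode_linear : linear S;
  antipodel : forall h,
    \tsum_(h1, h2 <- comul c h) (S h1 * h2) = counit c h *: 1;
  antipoder : forall h,
    \tsum_(h1, h2 <- comul c h) (h1 * S h2) = counit c h *: 1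
}.

Definition ad (H : algType K) (c : c3struct H) (S : H -> H) (h h' : H) : H :=
  \tsum_(h1, h2 <- comul c h) (h1 * h' * S h2).

Definition commutator (R : pzRingType) (x y : R) : R := x * y - y * x.

(* The action of [h : H] on [b : B] is [l (h \ox b)]. *)
Record is_augmented_rack_bialgebra (B : lmodType K) (cB : c3struct B)
    (H : algType K) (PhiB : B -> H) (cH : c3struct H) (SH : H -> H)
    (l : tensor H B -> B) : Prop := {
  arb_c3 : is_c3coalgebra cB;
  arb_hopf : is_hopf_algebra cH SH;
  arb_hopfC : cocommutative cH;
  arb_Phi : is_c3morphism cB cH PhiB;
  arb_act : is_c3morphism (tensor_c3 cH cB) cB l;
  arb_act1 : forall b, l (1 \ox b) = b;
  arb_actM : forall g h b, l ((g * h) \ox b) = l (g \ox l (h \ox b));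
  arb_act_cone : forall h, l (h \ox cone cB) = counit cH h *: cone cB;
  arb_Phi_act : forall h a, PhiB (l (h \ox a)) = ad cH SH h (PhiB a)
}.

Definition rack_op (B : lmodType K) (H : algType K) (PhiB : B -> H)
    (l : tensor H B -> B) (a b : B) : B :=
  l (PhiB a \ox b).

Record is_dialgebra (D : lmodType K) (vd dv : D -> D -> D) : Prop := {
  vd_bilinear : bilinear vd;
  dv_bilinear : bilinear dv;
  vdA : associative vd;
  dvA : associative dv;
  dv_vd : forall a b c, vd (vd a b) c = vd (dv a b) c;
  vd_dv : forall a b c, dv a (dv b c) = dv a (vd b c);
  vd_dvA : forall a b c, dv (vd a b) c = vd a (dv b c)
}.

Definition bar_unit (D : Type) (vd dv : D -> D -> D) (e : D) : Prop :=
  forall a, vd e a = a /\ dv a e = a.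

Definition balanced (D : Type) (vd dv : D -> D -> D) (e : D) : Prop :=
  forall a, vd a e = dv e a.

Record is_cocommutative_hopf_dialgebra (A : lmodType K) (c : c3struct A)
    (vd dv : A -> A -> A) (S : A -> A) : Prop := {
  hd_c3 : is_c3coalgebra c;
  hd_C : cocommutative c;
  hd_dialgebra : is_dialgebra vd dv;
  hd_bar_unit : bar_unit vd dv (cone c);
  hd_balanced : balanced vd dv (cone c);
  hd_vd : is_c3morphism (tensor_c3 c c) c (fun t => \tsum_(a, b <- t) vd a b);
  hd_dv : is_c3morphism (tensor_c3 c c) c (fun t => \tsum_(a, b <- t) dv a b);
  hd_antipode : is_c3morphism c c S;
  hd_antipoder : forall a,
    \tsum_(a1, a2 <- comul c a) vd a1 (S a2) = counit c a *: cone c;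
  hd_antipodel : forall a,
    \tsum_(a1, a2 <- comul c a) dv (S a1) a2 = counit c a *: cone c
}.

Record is_augmented_dialgebra (A : lmodType K) (H : algType K) (Phi : A -> H)
    (lact : H -> A -> A) (ract : A -> H -> A) : Prop := {
  ad_lact_bilinear : bilinear lact;
  ad_ract_bilinear : bilinear ract;
  ad_lact1 : forall a, lact 1 a = a;
  ad_lactM : forall g h a, lact (g * h) a = lact g (lact h a);
  ad_ract1 : forall a, ract a 1 = a;
  ad_ractM : forall a g h, ract a (g * h) = ract (ract a g) h;
  ad_bimodule : forall g a h, ract (lact g a) h = lact g (ract a h);
  ad_Phi_linear : linear Phi;
  ad_Phi_lact : forall h a, Phi (lact h a) = h * Phi a;
  ad_Phi_ract : forall a h, Phi (ract a h) = Phi a * h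
}.

Definition aug_vd (A : lmodType K) (H : algType K) (Phi : A -> H)
    (lact : H -> A -> A) (x y : A) : A := lact (Phi x) y.
Definition aug_dv (A : lmodType K) (H : algType K) (Phi : A -> H)
    (ract : A -> H -> A) (x y : A) : A := ract x (Phi y).

Definition is_augmented_cocommutative_hopf_dialgebra (A : lmodType K)
    (c : c3struct A) (H : algType K) (Phi : A -> H)
    (lact : H -> A -> A) (ract : A -> H -> A) (S : A -> A) : Prop :=
  is_augmented_dialgebra Phi lact ract /\
  is_cocommutative_hopf_dialgebra c (aug_vd Phi lact) (aug_dv Phi ract) S.

Section Leibniz.
Variables (V : lmodType K) (br : V -> V -> V).
Implicit Types A L I : set V.

Definition submodule A : Prop :=
  A 0 /\ forall (a : K) x y, A x -> A y -> A (a *: x + y).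

(* [A] with the bracket restricted from the ambient module [V], where [br] need
   not be bilinear or satisfy the Leibniz identity outside [A]. *)
Record is_leibniz_algebra A : Prop := {
  leib_submodule : submodule A;
  leib_closed : forall x y, A x -> A y -> A (br x y);
  leib_linearl : forall (a : K) x y z, A x -> A y -> A z ->
    br (a *: x + y) z = a *: br x z + br y z;
  leib_linearr : forall (a : K) x y z, A x -> A y -> A z ->
    br z (a *: x + y) = a *: br z x + br z y;
  leib_identity : forall x y z, A x -> A y -> A z ->
    br x (br y z) = br (br x y) z + br y (br x z)
}.

(* For an alternating bracket the Leibniz identity is the Jacobi identity. *)
Record is_lie_subalgebra A L : Prop := {
  lie_sub : (L `<=` A)%classic;
  lie_leibniz : is_leibniz_algebra L;
  lie_alternating : forall x, L x -> br x x = 0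
}.

Record is_two_sided_ideal A I : Prop := {
  ideal_sub : (I `<=` A)%classic;
  ideal_submodule : submodule I;
  ideal_l : forall x z, A x -> I z -> I (br x z);
  ideal_r : forall x z, A x -> I z -> I (br z x)
}.

Definition left_center A : set V :=
  [set z | A z /\ forall w, A w -> br z w = 0]%classic.

Definition direct_sum A L I : Prop :=
  [/\ submodule L, submodule I,
      forall z, A z <-> exists u v, [/\ L u, I v & z = u + v] &
      forall z, L z -> I z -> z = 0].
End Leibniz.

Section TensorDialgebra.
Variables (B : lmodType K) (H : algType K) (cB : c3struct B) (cH : c3struct H).
Variables (SH : H -> H) (PhiB : B -> H) (l : tensor H B -> B).

Definition BH_Phi (X : tensor B H) : H := \tsum_(b, h <- X) (PhiB b * h).

Definition BH_lact (h' : H) (X : tensor B H) : tensor B H :=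
  \tsum_(h1, h2 <- comul cH h') \tsum_(b, h <- X)
    (l (h1 \ox b) \ox (h2 * h)).

Definition BH_ract (X : tensor B H) (h' : H) : tensor B H :=
  \tsum_(b, h <- X) (b \ox (h * h')).

Definition BH_antipode (X : tensor B H) : tensor B H :=
  \tsum_(b, h <- X) (cone cB \ox SH (PhiB b * h)).
End TensorDialgebra.

End Structures.

(* Main.v *)
Require Import Defs.
From HB Require Import structures.
From mathcomp Require Import all_boot all_order all_algebra.
From mathcomp Require Import boolp classical_sets functions.

Set Implicit Arguments.
Unset Strict Implicit.
Unset Printing Implicit Defensive.

Import GRing.Theory.
Local Open Scope classical_set_scope.
Local Open Scope ring_scope.

(** Everything is a computation with Sweedler sums: an identity between
    multilinear maps is checked on elementary tensors, where coassociativity,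
    the counit, cocommutativity and the compatibility of a coalgebra map with
    the comultiplications become rewriting rules ([sweedlerA],
    [sweedler_counitl], [sweedlerC], [c3mor_sweedler]).

    The map [Phi (b \ox h) = PhiB b * h] commutes with the left action because
    [PhiB] turns the action into the adjoint action and
    [ad_(g1) (h) * g2 = g * h] ([adjoint_mul]).  Hence [B \ox H] is an augmented
    dialgebra, and the dialgebra axioms follow formally
    ([augmented_is_dialgebra]).  For the Hopf axioms, [Phi] and the two actions
    are coalgebra maps, so both multiplications, being built from them, are
    coalgebra maps too.  For the left action this needs the cocommutativity of
    [H], which allows the middle factors of an iterated comultiplication to be
    exchanged ([sweedler_interchange]).  The antipode is [Phi] followed by the
    antipode of [H] and the inclusion of [H]; it respects the comultiplication
    because a convolution inverse is unique ([comul_antipode]) and [H] is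
    cocommutative.  As [S X] lies in [1 \ox H], on
    which the left action of [g] reduces to multiplication by [g], the antipode
    identities for [B \ox H] are those of [H].

    A primitive element [X] is recovered from its images under
    [id \ox counit] and [counit \ox id]: applying their tensor product to
    [comul X] gives back [X] ([tensor_fst_snd]), while on
    [X \ox 1 + 1 \ox X] it gives [fst X \ox 1 + 1 \ox snd X].  This identifies
    the primitives with pairs in [Prim B * Prim H], and the bracket formula follows
    from the action of the primitive element [Phi X].  The bracket [[Z, W]]
    depends on [Z] only through [Phi Z], so the elements [x - PhiB x], on which
    [Phi] vanishes, are left central; they form an ideal because [PhiB]
    intertwines [p.x] with the commutator [[p, PhiB x]]. *)

(** * Multilinear maps and Sweedler sums *)

Section Multilinear.
Variable K : comNzRingType.
Implicit Types U V W X Y M N : lmodType K.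

(** A constant of its own, with source and target both modules over [K], so
    that [linearity] below can recognise its goals by their head symbol. *)
Definition islin U V (f : U -> V) : Prop := linear f.

Definition bilin U V W (f : U -> V -> W) : Prop :=
  (forall y, islin (f^~ y)) /\ (forall x, islin (f x)).

Definition trilin U V W X (f : U -> V -> W -> X) : Prop :=
  [/\ forall y z, islin (fun x => f x y z),
      forall x z, islin (fun y => f x y z) &
      forall x y, islin (fun z => f x y z)].

Section LinearFacts.
Variables (U V : lmodType K) (f : U -> V).
Hypothesis fL : islin f.

Lemma linD x y : f (x + y) = f x + f y.
Proof. by have /= := fL 1 x y; rewrite !scale1r. Qed.

Lemma lin0 : f 0 = 0.
Proof. by apply: (addIr (f 0)); rewrite add0r -linD addr0. Qed.

Lemma linZ a x : f (a *: x) = a *: f x.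
Proof. by have /= := fL a x 0; rewrite lin0 !addr0. Qed.

Lemma linN x : f (- x) = - f x.
Proof. by rewrite -scaleN1r linZ scaleN1r. Qed.

Lemma linB x y : f (x - y) = f x - f y.
Proof. by rewrite linD linN. Qed.
End LinearFacts.

Lemma lin_id U : islin (fun x : U => x).
Proof. by []. Qed.

Lemma lin_comp U V W (g : V -> W) (f : U -> V) :
  islin g -> islin f -> islin (fun x => g (f x)).
Proof. by move=> gL fL a x y; rewrite fL gL. Qed.

Lemma lin_compl U V W X (g : V -> W -> X) (f : U -> V) c :
  bilin g -> islin f -> islin (fun x => g (f x) c).
Proof. by move=> [gL _] fL a x y; rewrite fL (gL c). Qed.

Lemma lin_compr U V W X (g : W -> V -> X) c (f : U -> V) :
  bilin g -> islin f -> islin (fun x => g c (f x)).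
Proof. by move=> [_ gL] fL a x y; rewrite fL gL. Qed.

Lemma lin_comp31 U V W X Y (g : V -> W -> X -> Y) (f : U -> V) c d :
  trilin g -> islin f -> islin (fun x => g (f x) c d).
Proof. by case=> gL _ _ fL a x y; rewrite fL (gL c d). Qed.

Lemma lin_comp32 U V W X Y (g : W -> V -> X -> Y) (f : U -> V) c d :
  trilin g -> islin f -> islin (fun x => g c (f x) d).
Proof. by case=> _ gL _ fL a x y; rewrite fL (gL c d). Qed.

Lemma lin_comp33 U V W X Y (g : W -> X -> V -> Y) (f : U -> V) c d :
  trilin g -> islin f -> islin (fun x => g c d (f x)).
Proof. by case=> _ _ gL fL a x y; rewrite fL (gL c d). Qed.

Lemma lin_add U V (f g : U -> V) :
  islin f -> islin g -> islin (fun x => f x + g x).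
Proof. by move=> fL gL a x y; rewrite fL gL scalerDr addrACA. Qed.

Lemma lin_opp U V (f : U -> V) : islin f -> islin (fun x => - f x).
Proof. by move=> fL a x y; rewrite fL opprD scalerN. Qed.

Lemma lin_scale U V (f : U -> V) k : islin f -> islin (fun x => k *: f x).
Proof. by move=> fL a x y; rewrite fL scalerDr !scalerA mulrC. Qed.

Lemma lin_scalel U V (f : U -> K) (v : V) :
  islin (f : U -> K^o) -> islin (fun x => f x *: v).
Proof. by move=> fL a x y; rewrite fL scalerDl scalerA. Qed.

Lemma lin_tsum_arg U V W X (F : V -> W -> X) (f : U -> tensor V W) :
  bilin F -> islin f -> islin (fun x => tsum F (f x)).
Proof. by move=> FL fL a x y; rewrite fL (tsum_linear _) //; case: FL. Qed.

Lemma lin_tsum_fun U V W X (F : U -> V -> W -> X) t :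
  (forall y z, islin (fun x => F x y z)) -> islin (fun x => tsum (F x) t).
Proof.
move=> FL a x y; rewrite /tsum scaler_sumr -big_split.
by apply: eq_bigr => p _; rewrite (FL p.1 p.2 a x y).
Qed.

Lemma bilin_pure U V : bilin (@pure K U V).
Proof. by case: (pure_bilinear U V). Qed.

Lemma bilin_mul (H : algType K) : bilin (@GRing.mul H).
Proof.
split=> x a y z; first by rewrite mulrDl scalerAl.
by rewrite mulrDr scalerAr.
Qed.

Section Sums.
Variables U V : lmodType K.
Implicit Types t : tensor U V.

Lemma bilinP W (F : U -> V -> W) : bilin F -> bilinear_for *:%R *:%R F.
Proof. by case. Qed.

Lemma eq_tsum (M : nmodType) (F G : U -> V -> M) t :
  (forall x y, F x y = G x y) -> tsum F t = tsum G t.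
Proof. by move=> FG; apply: eq_bigr => p _; apply: FG. Qed.

Lemma tsumP W (F : U -> V -> W) x y : bilin F -> tsum F (x \ox y) = F x y.
Proof. by move/bilinP/tsum_pure. Qed.

Lemma lin_tsum W X (g : W -> X) (F : U -> V -> W) t :
  islin g -> g (tsum F t) = tsum (fun x y => g (F x y)) t.
Proof. by move=> gL; apply: (big_morph g (linD gL) (lin0 gL)). Qed.

(** Elementary tensors generate; nearly all identities below start with this
    reduction. *)
Lemma tensor_ext W (f g : tensor U V -> W) :
  islin f -> islin g -> (forall x y, f (x \ox y) = g (x \ox y)) -> f =1 g.
Proof.
move=> fL gL fg t; rewrite (tsum_unique (f := fun x y => f (x \ox y)) fL) //.
by rewrite (tsum_unique (f := fun x y => f (x \ox y)) gL).
Qed.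

Lemma tsum_puresE t : \tsum_(x, y <- t) (x \ox y) = t.
Proof. by rewrite /tsum -tensor_sum_pure. Qed.
End Sums.

Lemma tsum_tsum U V U' V' W (G : U' -> V' -> W) (F : U -> V -> tensor U' V') t :
  bilin G -> tsum G (tsum F t) = tsum (fun x y => tsum G (F x y)) t.
Proof. by move=> GL; apply: lin_tsum; apply: tsum_linear; case: GL. Qed.

Lemma tsum_pures U V U' V' W (G : U' -> V' -> W) f g (t : tensor U V) :
  bilin G ->
  tsum G (\tsum_(x, y <- t) (f x y \ox g x y)) =
    \tsum_(x, y <- t) G (f x y) (g x y).
Proof.
by move=> GL; rewrite tsum_tsum //; apply: eq_tsum => x y; apply: tsumP.
Qed.

(** A Sweedler sum is a sum over a chosen representative, so exchanging two of
    them requires no bilinearity. *)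
Lemma tsum_exchange U V U' V' (M : nmodType)
    (F : U -> V -> U' -> V' -> M) t t' :
  \tsum_(x, y <- t) \tsum_(z, w <- t') F x y z w =
  \tsum_(z, w <- t') \tsum_(x, y <- t) F x y z w.
Proof. exact: exchange_big. Qed.

Lemma pure_tsum U V U' V' M N (F : U -> V -> M) (G : U' -> V' -> N) t t' :
  tsum F t \ox tsum G t' =
  \tsum_(x, y <- t) \tsum_(z, w <- t') (F x y \ox G z w).
Proof.
rewrite (lin_tsum _ _ ((bilin_pure M N).1 (tsum G t'))); apply: eq_tsum => x y.
by rewrite (lin_tsum _ _ ((bilin_pure M N).2 (F x y))).
Qed.

End Multilinear.

Section KnownLinear.
Variable K : comNzRingType.

Lemma lin_comul (C : lmodType K) (c : c3struct C) :
  is_c3coalgebra c -> islin (comul c).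
Proof. exact: comul_linear. Qed.

Lemma lin_counit (C : lmodType K) (c : c3struct C) :
  is_c3coalgebra c -> islin (counit c : C -> K^o).
Proof. exact: counit_linear. Qed.

Lemma lin_c3mor (C D : lmodType K) (c : c3struct C) (d : c3struct D) f :
  is_c3morphism c d f -> islin f.
Proof. exact: c3mor_linear. Qed.

Lemma lin_antipode (H : algType K) (c : c3struct H) S :
  is_hopf_algebra c S -> islin S.
Proof. exact: antipode_linear. Qed.

Lemma lin_counit_comp (C U : lmodType K) (c : c3struct C) (f : U -> C) :
  islin (counit c : C -> K^o) -> islin f ->
    islin (fun x => counit c (f x) : K^o).
Proof. exact: lin_comp. Qed.
End KnownLinear.

(** Closes linearity goals for the structure maps, by the linearity recorded in
    the structure that the context provides. *)
Ltac linear_atom :=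
  first
  [ assumption
  | eapply lin_comul; eassumption
  | eapply lin_counit; eassumption
  | eapply lin_antipode; eassumption
  | eapply lin_c3mor; eassumption ].

Ltac linearity_step :=
  cbv beta;
  match goal with
  | gL : bilin ?g |- bilin ?g => exact gL
  | gL : trilin ?g |- trilin ?g => exact gL
  | |- bilin _ => split
  | |- trilin _ => split
  | |- forall _, _ => intro
  | |- islin (fun x => x) => exact (@lin_id _ _)
  | |- islin (fun x => pure (@?f x) ?c) =>
      apply (lin_compl (f := f) c (bilin_pure _ _))
  | |- islin (fun x => pure ?c (@?f x)) =>
      apply (lin_compr (f := f) c (bilin_pure _ _))
  | |- islin (fun x => GRing.mul (@?f x) ?c) =>
      apply (lin_compl (f := f) c (bilin_mul _))
  | |- islin (fun x => GRing.mul ?c (@?f x)) =>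
      apply (lin_compr (f := f) c (bilin_mul _))
  | |- islin (fun x => GRing.add _ _) => apply lin_add
  | |- islin (fun x => GRing.opp _) => apply lin_opp
  | |- islin (fun x => GRing.scale ?k _) => apply lin_scale
  | |- islin (fun x => GRing.scale (@?f x) ?v) => apply (lin_scalel (f := f) v)
  | |- islin (fun x => tsum ?F (@?f x)) =>
      apply (lin_tsum_arg (F := F) (f := f))
  | |- islin (fun x => tsum _ _) => apply lin_tsum_fun
  | |- islin _ => linear_atom
  | gL : bilin ?g |- islin (?g ?a) => exact (proj2 gL a)
  | |- islin (fun x => counit ?c (@?f x)) =>
      lazymatch f with
      | (fun x => x) => fail
      | _ => apply (lin_counit_comp (c := c) (f := f))
      end
  | gL : bilin ?g |- islin (fun x => ?g (@?f x) ?c) =>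
      apply (lin_compl (f := f) c gL)
  | gL : bilin ?g |- islin (fun x => ?g ?c (@?f x)) =>
      apply (lin_compr (f := f) c gL)
  | gL : trilin ?g |- islin (fun x => ?g (@?f x) ?c ?d) =>
      apply (lin_comp31 (f := f) _ _ gL)
  | gL : trilin ?g |- islin (fun x => ?g ?c (@?f x) ?d) =>
      apply (lin_comp32 (f := f) _ _ gL)
  | gL : trilin ?g |- islin (fun x => ?g ?c ?d (@?f x)) =>
      apply (lin_comp33 (f := f) _ _ gL)
  | |- islin (fun x => ?g (@?f x)) =>
      lazymatch f with
      | (fun x => x) => fail
      | _ => apply (lin_comp (g := g) (f := f))
      end
  end.

(** Proves (multi)linearity by recursion on the expression.  The variable must
    occur in a single argument of each operation, as it does in a multilinear
    expression; the side conditions of the Sweedler rules are of this kind. *)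
Ltac linearity := repeat linearity_step.

(** * Coalgebras in Sweedler notation *)

Section Sweedler.
Variables (K : comNzRingType) (C : lmodType K) (c : c3struct C).
Hypothesis hc : is_c3coalgebra c.
Variable V : lmodType K.

(** Coassociativity tested against an arbitrary trilinear map: by the universal
    property, [F] amounts to a linear map on the triple tensor product. *)
Lemma sweedlerA (F : C -> C -> C -> V) x : trilin F ->
  \tsum_(u, x3 <- comul c x) \tsum_(x1, x2 <- comul c u) F x1 x2 x3 =
  \tsum_(x1, v <- comul c x) \tsum_(x2, x3 <- comul c v) F x1 x2 x3.
Proof.
move=> FL.
pose T := fun t : tensor C (tensor C C) =>
  \tsum_(x1, v <- t) \tsum_(x2, x3 <- v) F x1 x2 x3.
have TL : islin T by rewrite /T; linearity.
have := congr1 T (comulA hc x).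
rewrite /tensor_map {2}/T tsum_pures; last by linearity.
move=> /= <-; rewrite /tensor_assoc tsum_pures; last by linearity.
rewrite (lin_tsum _ _ TL); apply: eq_tsum => u x3.
rewrite (lin_tsum _ _ TL); apply: eq_tsum => x1 x2.
by rewrite /T !tsumP //; linearity.
Qed.

Lemma sweedler_counitl (f : C -> V) x : islin f ->
  \tsum_(x1, x2 <- comul c x) (counit c x1 *: f x2) = f x.
Proof.
move=> fL; rewrite -[in RHS](counitl hc x) (lin_tsum _ _ fL).
by apply: eq_tsum => x1 x2; rewrite linZ.
Qed.

Lemma sweedler_counitr (f : C -> V) x : islin f ->
  \tsum_(x1, x2 <- comul c x) (counit c x2 *: f x1) = f x.
Proof.
move=> fL; rewrite -[in RHS](counitr hc x) (lin_tsum _ _ fL).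
by apply: eq_tsum => x1 x2; rewrite linZ.
Qed.

Lemma sweedlerC (F : C -> C -> V) x : cocommutative c -> bilin F ->
  \tsum_(x1, x2 <- comul c x) F x1 x2 = \tsum_(x1, x2 <- comul c x) F x2 x1.
Proof.
by move=> cC FL; rewrite -[in LHS]cC /tensor_swap tsum_pures.
Qed.

(** By coassociativity both sides are sums over the fourfold comultiplication
    with the two middle factors next to each other, as the two legs of a single
    [comul u]; cocommutativity then exchanges them. *)
Lemma sweedler_interchange (F : C -> C -> C -> C -> V) x : cocommutative c ->
  (forall a, trilin (F a)) -> (forall b c d, islin (fun a => F a b c d)) ->
  \tsum_(u, v <- comul c x) \tsum_(x1, x2 <- comul c u) 
    \tsum_(x3, x4 <- comul c v) F x1 x2 x3 x4 =
  \tsum_(u, v <- comul c x) \tsum_(x1, x2 <- comul c u) 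
    \tsum_(x3, x4 <- comul c v) F x1 x3 x2 x4.
Proof.
move=> cC FL F1.
have aux (G : C -> C -> C -> C -> V) : (forall a, trilin (G a)) ->
    (forall b c d, islin (fun a => G a b c d)) ->
  \tsum_(u, v <- comul c x) \tsum_(x1, x2 <- comul c u) 
    \tsum_(x3, x4 <- comul c v) G x1 x2 x3 x4 =
  \tsum_(x1, w <- comul c x) \tsum_(u, x4 <- comul c w) 
    \tsum_(x2, x3 <- comul c u) G x1 x2 x3 x4.
  move=> GL G1.
  rewrite (sweedlerA (F := fun x1 x2 v =>
    \tsum_(x3, x4 <- comul c v) G x1 x2 x3 x4)).
    by apply: eq_tsum => x1 w; rewrite sweedlerA //; apply: GL.
  split=> y z; first by linearity; apply: G1.
    by have := GL y; linearity.
  by have := GL y; linearity.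
rewrite !aux; first last.
- by [].
- by [].
- by move=> b d e; apply: F1.
- by move=> a; have := FL a; linearity.
apply: eq_tsum => x1 w; apply: eq_tsum => u x4; apply: sweedlerC => //.
by have := FL x1; linearity.
Qed.
End Sweedler.

Section Morphisms.
Variable K : comNzRingType.

Lemma c3mor_sweedler (C D V : lmodType K) (c : c3struct C) (d : c3struct D) f
    (F : D -> D -> V) x : is_c3morphism c d f -> bilin F ->
  \tsum_(y1, y2 <- comul d (f x)) F y1 y2 =
  \tsum_(x1, x2 <- comul c x) F (f x1) (f x2).
Proof. by move=> fM FL; rewrite (c3mor_comul fM) /tensor_map tsum_pures. Qed.

Lemma c3mor_comp (C D E : lmodType K) (c : c3struct C) (d : c3struct D)
    (e : c3struct E) f g :
  is_c3morphism c d f -> is_c3morphism d e g ->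
    is_c3morphism c e (fun x => g (f x)).
Proof.
move=> fM gM; split=> [|x|x|].
- exact: lin_comp (lin_c3mor gM) (lin_c3mor fM).
- rewrite (c3mor_comul gM) /tensor_map (c3mor_sweedler _ fM) //.
  by linearity.
- by rewrite (c3mor_counit gM) (c3mor_counit fM).
- by rewrite (c3mor_cone fM) (c3mor_cone gM).
Qed.
End Morphisms.

Section TensorCoalgebra.
Variables (K : comNzRingType) (C D : lmodType K) (c : c3struct C)
  (d : c3struct D).
Hypotheses (hc : is_c3coalgebra c) (hd : is_c3coalgebra d).

Lemma lin_comul_tensor : islin (comul (tensor_c3 c d)).
Proof. by rewrite /=; linearity. Qed.

Let K_bilin : bilin (fun x y => counit c x * counit d y : K^o).
Proof.
split=> [y a x x'|x a y y'] /=.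
  by rewrite (lin_counit hc a) mulrDl -mulrA.
by rewrite (lin_counit hd a) mulrDr /= mulrCA.
Qed.

Lemma lin_counit_tensor : islin (counit (tensor_c3 c d) : _ -> K^o).
Proof. exact: (tsum_linear (bilinP K_bilin)). Qed.

Lemma counit_pure x y :
  counit (tensor_c3 c d) (x \ox y) = counit c x * counit d y.
Proof. exact: (tsum_pure (bilinP K_bilin)). Qed.

Lemma comul_pure x y : comul (tensor_c3 c d) (x \ox y) =
  \tsum_(x1, x2 <- comul c x) \tsum_(y1, y2 <- comul d y)
    ((x1 \ox y1) \ox (x2 \ox y2)).
Proof. by rewrite /= tsumP //; linearity. Qed.

Lemma sweedler_tensor (V : lmodType K) (F : tensor C D -> tensor C D -> V) x y :
  bilin F ->
  \tsum_(u, v <- comul (tensor_c3 c d) (x \ox y)) F u v =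
  \tsum_(x1, x2 <- comul c x) \tsum_(y1, y2 <- comul d y)
    F (x1 \ox y1) (x2 \ox y2).
Proof.
move=> FL; rewrite comul_pure tsum_tsum //; apply: eq_tsum => x1 x2.
by rewrite tsum_pures.
Qed.

(** Both sides are the sum of [x1 \ox y1 \ox x2 \ox y2 \ox x3 \ox y3]; the two
    coassociativity laws apply once the sums over [x] and over [y] have been
    separated. *)
Lemma tensor_comulA t :
  let cd := tensor_c3 c d in
  tensor_assoc (tensor_map (comul cd) id (comul cd t)) =
  tensor_map id (comul cd) (comul cd t).
Proof.
move=> cd; have DL : islin (comul cd) := lin_comul_tensor.
move: t; apply: tensor_ext; rewrite /tensor_assoc /tensor_map.
- by linearity.
- by linearity.
move=> x y; rewrite tsum_pures; last by linearity.
rewrite !sweedler_tensor; try by linearity.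
transitivity (\tsum_(u, x3 <- comul c x) \tsum_(x1, x2 <- comul c u)
  \tsum_(v, y3 <- comul d y) \tsum_(y1, y2 <- comul d v)
    ((x1 \ox y1) \ox ((x2 \ox y2) \ox (x3 \ox y3)))).
  apply: eq_tsum => u x3; rewrite [RHS]tsum_exchange; apply: eq_tsum => v y3.
  by rewrite sweedler_tensor //; linearity.
rewrite sweedlerA //; last by linearity.
apply: eq_tsum => x1 u.
transitivity (\tsum_(x2, x3 <- comul c u) \tsum_(y1, v <- comul d y)
  \tsum_(y2, y3 <- comul d v) ((x1 \ox y1) \ox ((x2 \ox y2) \ox (x3 \ox y3)))).
  apply: eq_tsum => x2 x3; rewrite sweedlerA //; linearity.
rewrite tsum_exchange; apply: eq_tsum => y1 v.
rewrite comul_pure (lin_tsum _ _ (g := fun t => (x1 \ox y1) \ox t));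
  last by linearity.
apply: eq_tsum => x2 x3.
by rewrite (lin_tsum _ _ (g := fun t => (x1 \ox y1) \ox t)) //; linearity.
Qed.

Lemma tensor_c3coalgebra : is_c3coalgebra (tensor_c3 c d).
Proof.
have DL := lin_comul_tensor; have eL := lin_counit_tensor.
split.
- exact: lin_comul_tensor.
- exact: lin_counit_tensor.
- exact: tensor_comulA.
- apply: tensor_ext; [by linearity|exact: lin_id|move=> x y].
  rewrite sweedler_tensor; last by linearity.
  rewrite -[RHS](sweedler_counitl hc (f := fun x => x \ox y));
    last by linearity.
  apply: eq_tsum => x1 x2;
    rewrite -(sweedler_counitl hd (f := fun y => x2 \ox y)); last by linearity.
  rewrite (lin_tsum _ _ (g := fun t => counit c x1 *: t)); last by linearity.
  by apply: eq_tsum => y1 y2; rewrite counit_pure scalerA.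
- apply: tensor_ext; [by linearity|exact: lin_id|move=> x y].
  rewrite sweedler_tensor; last by linearity.
  rewrite -[RHS](sweedler_counitr hc (f := fun x => x \ox y));
    last by linearity.
  apply: eq_tsum => x1 x2;
    rewrite -(sweedler_counitr hd (f := fun y => x1 \ox y)); last by linearity.
  rewrite (lin_tsum _ _ (g := fun t => counit c x2 *: t)); last by linearity.
  by apply: eq_tsum => y1 y2; rewrite counit_pure scalerA.
- rewrite comul_pure (comul_cone hc) (comul_cone hd).
  by rewrite !tsumP //; linearity.
- by rewrite counit_pure (counit_cone hc) (counit_cone hd) mulr1.
Qed.

Lemma tensor_cocommutative :
  cocommutative c -> cocommutative d -> cocommutative (tensor_c3 c d).
Proof.
have DL := lin_comul_tensor.
move=> cC dC; apply: tensor_ext; rewrite ?/tensor_swap; try by linearity.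
move=> x y; rewrite sweedler_tensor; last by linearity.
rewrite comul_pure [RHS]sweedlerC //; last by linearity.
by apply: eq_tsum => x1 x2; rewrite [RHS]sweedlerC //; linearity.
Qed.

Lemma tensor_c3morphism (E : lmodType K) (e : c3struct E) (F : C -> D -> E) :
  bilin F -> islin (comul e) -> islin (counit e : E -> K^o) ->
  (forall x y, comul e (F x y) =
    \tsum_(x1, x2 <- comul c x) \tsum_(y1, y2 <- comul d y)
      (F x1 y1 \ox F x2 y2)) ->
  (forall x y, counit e (F x y) = counit c x * counit d y) ->
  F (cone c) (cone d) = cone e ->
  is_c3morphism (tensor_c3 c d) e (tsum F).
Proof.
have DL := lin_comul_tensor; have eL := lin_counit_tensor.
move=> FL DeL eeL FD Fe F1; split.
- exact: (tsum_linear (bilinP FL)).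
- apply: tensor_ext; rewrite ?/tensor_map; try by linearity.
  move=> x y; rewrite tsumP // FD sweedler_tensor; last by linearity.
  by apply: eq_tsum => x1 x2; apply: eq_tsum => y1 y2; rewrite !tsumP.
- apply: (tensor_ext (W := K^o)); [by linearity|by []|].
  by move=> x y; rewrite counit_pure -Fe tsumP.
- by rewrite tsumP.
Qed.

Lemma inl_c3morphism : is_c3morphism c (tensor_c3 c d) (fun x => x \ox cone d).
Proof.
split=> [|x|x|].
- exact: (bilin_pure C D).1.
- rewrite comul_pure // (comul_cone hd); apply: eq_tsum => x1 x2.
  by rewrite tsumP //; linearity.
- by rewrite counit_pure // (counit_cone hd) mulr1.
- by [].
Qed.

Lemma inr_c3morphism : is_c3morphism d (tensor_c3 c d) (fun y => cone c \ox y).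
Proof.
split=> [|x|x|].
- exact: (bilin_pure C D).2.
- rewrite comul_pure // (comul_cone hc) tsumP; last by linearity.
  by [].
- by rewrite counit_pure // (counit_cone hc) mul1r.
- by [].
Qed.
End TensorCoalgebra.

(** * The antipode of a cocommutative Hopf algebra *)

Section Convolution.
Variables (K : comNzRingType) (C T : lmodType K) (c : c3struct C).
Hypothesis hc : is_c3coalgebra c.
Variables (m : T -> T -> T) (e : T).
Hypotheses (mL : bilin m) (mA : associative m).
Hypotheses (m1l : left_id e m) (m1r : right_id e m).

(** A left convolution inverse [f] and a right convolution inverse [f'] of [g]
    agree, as in any monoid: [f = f * (g * f') = (f * g) * f' = f'], with
    coassociativity providing the middle equality. *)
Lemma convolution_inverse_unique (f g f' : C -> T) :
  islin f -> islin g -> islin f' ->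
  (forall x, \tsum_(x1, x2 <- comul c x) m (f x1) (g x2) = counit c x *: e) ->
  (forall x, \tsum_(x1, x2 <- comul c x) m (g x1) (f' x2) = counit c x *: e) ->
  f =1 f'.
Proof.
move=> fL gL f'L fg gf' x.
have mZl a s t : m (a *: s) t = a *: m s t by apply: (linZ (mL.1 t)).
have mZr a s t : m s (a *: t) = a *: m s t by apply: (linZ (mL.2 s)).
transitivity (\tsum_(x1, v <- comul c x) \tsum_(x2, x3 <- comul c v)
  m (f x1) (m (g x2) (f' x3))).
  rewrite -(sweedler_counitr hc x fL); apply: eq_tsum => x1 v.
  by rewrite -(lin_tsum _ _ (mL.2 (f x1))) gf' mZr m1r.
rewrite -(sweedlerA hc); last by linearity.
rewrite -(sweedler_counitl hc x f'L); apply: eq_tsum => u x3.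
rewrite -[RHS](congr1 _ (m1l (f' x3))) -mZl -fg (lin_tsum _ _ (mL.1 (f' x3))).
by apply: eq_tsum => x1 x2; rewrite mA.
Qed.
End Convolution.

Section Antipode.
Variables (K : comNzRingType) (H : algType K) (c : c3struct H) (S : H -> H).
Hypothesis hH : is_hopf_algebra c S.

Let hc : is_c3coalgebra c := hopf_c3 hH.

Lemma comul1 : comul c 1 = 1 \ox 1.
Proof. by rewrite -(hopf_cone hH) (comul_cone hc). Qed.

Lemma counit1 : counit c 1 = 1.
Proof. by rewrite -(hopf_cone hH) (counit_cone hc). Qed.

Lemma antipode1 : S 1 = 1.
Proof.
have := antipodel hH 1; rewrite comul1 tsumP; last by linearity.
by rewrite mulr1 counit1 scale1r.
Qed.

Lemma counit_antipode h : counit c (S h) = counit c h.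
Proof.
have eL := lin_counit hc.
have := congr1 (counit c) (antipodel hH h).
rewrite (linZ eL) counit1 [X in _ = X -> _]mulr1 => <-.
rewrite (lin_tsum _ _ eL) -[in LHS](counitr hc h)
  (lin_tsum _ _ (lin_antipode hH)).
rewrite (lin_tsum _ _ eL); apply: eq_tsum => h1 h2.
by rewrite (linZ (lin_antipode hH)) (linZ eL) (hopf_counitM hH) [LHS]mulrC.
Qed.

(** The multiplication of the tensor product algebra; [hopf_comulM] says that
    [comul] is multiplicative for it. *)
Definition tensor_mul (s t : tensor H H) : tensor H H :=
  \tsum_(a, b <- s) \tsum_(a', b' <- t) ((a * a') \ox (b * b')).

Lemma tensor_mul_bilin : bilin tensor_mul.
Proof. by rewrite /tensor_mul; linearity. Qed.

Lemma tensor_mul_pure a b a' b' :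
  tensor_mul (a \ox b) (a' \ox b') = (a * a') \ox (b * b').
Proof. by rewrite /tensor_mul !tsumP //; linearity. Qed.

Lemma tensor_mulA : associative tensor_mul.
Proof.
have mL := tensor_mul_bilin.
move=> s t u; move: s; apply: tensor_ext; try by linearity.
move=> a b; move: t; apply: tensor_ext; try by linearity.
move=> a' b'; move: u; apply: tensor_ext; try by linearity.
by move=> a'' b''; rewrite !tensor_mul_pure !mulrA.
Qed.

Lemma tensor_mul1l : left_id (1 \ox 1) tensor_mul.
Proof.
have mL := tensor_mul_bilin.
apply: tensor_ext; try by linearity.
by move=> a b; rewrite tensor_mul_pure !mul1r.
Qed.

Lemma tensor_mul1r : right_id (1 \ox 1) tensor_mul.
Proof.
have mL := tensor_mul_bilin.
apply: tensor_ext; try by linearity.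
by move=> a b; rewrite tensor_mul_pure !mulr1.
Qed.

(** Both sides are convolution inverses of [comul] in the linear maps from [H]
    to [H \ox H]: the left one because [comul] is multiplicative, the right one
    because [h1 * S h4 \ox h2 * S h3] collapses from the inside. *)
Lemma comul_antipode h :
  comul c (S h) = \tsum_(h1, h2 <- comul c h) (S h2 \ox S h1).
Proof.
have mL := tensor_mul_bilin.
move: h; apply: (convolution_inverse_unique hc mL tensor_mulA tensor_mul1l
  tensor_mul1r (g := comul c)) => [|||h|h]; try by linearity.
- rewrite -comul1 -(linZ (lin_comul hc)) -(antipodel hH).
  rewrite (lin_tsum _ _ (lin_comul hc)); apply: eq_tsum => h1 h2.
  by rewrite (hopf_comulM hH).
transitivity (\tsum_(u, v <- comul c h) \tsum_(a, b <- comul c u)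
    \tsum_(a', b' <- comul c v) ((a * S b') \ox (b * S a'))).
  apply: eq_tsum => u v; apply: eq_tsum => a b.
  by rewrite tsum_pures //; linearity.
(* Regroup so that [b] and [a'] become the two legs of one comultiplication. *)
rewrite (sweedlerA hc (F := fun a b v =>
  \tsum_(a', b' <- comul c v) ((a * S b') \ox (b * S a')))); last by linearity.
transitivity (\tsum_(a, w <- comul c h) ((a * S w) \ox (1 : H))).
  apply: eq_tsum => a w; rewrite -(sweedlerA hc); last by linearity.
  rewrite -(sweedler_counitl hc w (f := fun w => (a * S w) \ox (1 : H)));
    last by linearity.
  apply: eq_tsum => u b'.
  have pL : islin (fun g : H => (a * S b') \ox g) by linearity.
  by rewrite -(linZ pL) -(antipoder hH) (lin_tsum _ _ pL).
have pL : islin (fun g : H => g \ox (1 : H)) by linearity.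
by rewrite -(linZ pL) -(antipoder hH) (lin_tsum _ _ pL).
Qed.

Lemma antipode_c3morphism : cocommutative c -> is_c3morphism c c S.
Proof.
move=> cC; split=> [|h|h|].
- exact: lin_antipode hH.
- by rewrite comul_antipode -sweedlerC //; linearity.
- exact: counit_antipode.
- by rewrite (hopf_cone hH) antipode1.
Qed.
End Antipode.

(** * Dialgebras and their Leibniz brackets *)

Section Dialgebra.
Variable K : comNzRingType.

Lemma augmented_is_dialgebra (A : lmodType K) (H : algType K) (Phi : A -> H)
  lact ract :
  is_augmented_dialgebra Phi lact ract ->
  is_dialgebra (aug_vd Phi lact) (aug_dv Phi ract).
Proof.
case=> lL rL _ lM _ rM lr PL Pl Pr; rewrite /aug_vd /aug_dv.
have lB : bilin lact by case: lL.
have rB : bilin ract by case: rL.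
have {}PL : islin Phi := PL.
split.
- by apply: bilinP; linearity.
- by apply: bilinP; linearity.
- by move=> x y z; rewrite Pl lM.
- by move=> x y z; rewrite Pr rM.
- by move=> x y z; rewrite Pl Pr.
- by move=> x y z; rewrite Pl Pr.
- by move=> x y z; rewrite lr.
Qed.

Section Bracket.
Variables (A : lmodType K) (vd dv : A -> A -> A).
Hypothesis hA : is_dialgebra vd dv.
Let br x y := vd x y - dv y x.

Let vL : bilin vd. Proof. by case: (vd_bilinear hA). Qed.
Let dL : bilin dv. Proof. by case: (dv_bilinear hA). Qed.

Lemma dialgebra_bracket_bilin : bilin br.
Proof. by rewrite /br; linearity. Qed.

(** The dialgebra axioms reduce the twelve products to six normal forms, which
    cancel. *)
Lemma dialgebra_bracket_leibniz x y z :
  br x (br y z) = br (br x y) z + br y (br x z).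
Proof.
rewrite /br !(linB (vL.1 _), linB (vL.2 _), linB (dL.1 _), linB (dL.2 _)).
have -> : vd (vd x y) z = vd x (vd y z) by rewrite (vdA hA).
have -> : vd (dv y x) z = vd y (vd x z) by rewrite -(dv_vd hA) (vdA hA).
have -> : dv z (vd x y) = dv (dv z x) y by rewrite -(vd_dv hA) (dvA hA).
rewrite (dvA hA z y x) !(vd_dvA hA) !opprB.
by rewrite [RHS]addrACA !subrKA addrACA [RHS]addrACA [- vd x _ - _]addrC.
Qed.
End Bracket.
End Dialgebra.

(** * The Hopf dialgebra on the tensor product *)

Section TensorHopfDialgebra.
Variables (K : comNzRingType) (B : lmodType K) (H : algType K).
Variables (cB : c3struct B) (cH : c3struct H).
Variables (SH : H -> H) (PhiB : B -> H) (l : tensor H B -> B).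
Hypothesis hR : is_augmented_rack_bialgebra cB PhiB cH SH l.

Let hB : is_c3coalgebra cB := arb_c3 hR.
Let hH : is_hopf_algebra cH SH := arb_hopf hR.
Let hcH : is_c3coalgebra cH := hopf_c3 hH.
Let cC : cocommutative cH := arb_hopfC hR.
Let PhiM : is_c3morphism cB cH PhiB := arb_Phi hR.
Let actM : is_c3morphism (tensor_c3 cH cB) cB l := arb_act hR.
Let actL : islin l := lin_c3mor actM.

Let cBH := tensor_c3 cB cH.
Let hBH : is_c3coalgebra cBH := tensor_c3coalgebra hB hcH.
Let Phi : tensor B H -> H := BH_Phi PhiB.
Let lact := BH_lact cH l.
Let ract : tensor B H -> H -> tensor B H := @BH_ract K B H.
Let S := BH_antipode cB SH PhiB.

Lemma Phi_cone : PhiB (cone cB) = 1.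
Proof. by rewrite (c3mor_cone PhiM) (hopf_cone hH). Qed.

Lemma comul_act h b : comul cB (l (h \ox b)) =
  \tsum_(h1, h2 <- comul cH h) \tsum_(b1, b2 <- comul cB b)
    (l (h1 \ox b1) \ox l (h2 \ox b2)).
Proof.
by rewrite (c3mor_comul actM) /tensor_map sweedler_tensor //; linearity.
Qed.

Lemma counit_act h b : counit cB (l (h \ox b)) = counit cH h * counit cB b.
Proof. by rewrite (c3mor_counit actM) counit_pure. Qed.

Lemma BH_Phi_pure b h : Phi (b \ox h) = PhiB b * h.
Proof. by rewrite /Phi /BH_Phi tsumP //; linearity. Qed.

Lemma BH_lact_pure g b h : lact g (b \ox h) =
  \tsum_(g1, g2 <- comul cH g) (l (g1 \ox b) \ox (g2 * h)).
Proof.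
by rewrite /lact /BH_lact; apply: eq_tsum => g1 g2; rewrite tsumP //; linearity.
Qed.

Lemma BH_ract_pure b h g : ract (b \ox h) g = b \ox (h * g).
Proof. by rewrite /ract /BH_ract tsumP //; linearity. Qed.

Lemma BH_Phi_lin : islin Phi.
Proof. by rewrite /Phi /BH_Phi; linearity. Qed.

Lemma BH_lact_bilin : bilin lact.
Proof. by rewrite /lact /BH_lact; linearity. Qed.

Lemma BH_ract_bilin : bilin ract.
Proof. by rewrite /ract /BH_ract; linearity. Qed.

Let PL := BH_Phi_lin.
Let lL := BH_lact_bilin.
Let rL := BH_ract_bilin.

Lemma BH_antipodeE X : S X = cone cB \ox SH (Phi X).
Proof.
rewrite /S /BH_antipode /Phi /BH_Phi.
by rewrite [RHS](lin_tsum _ _ (g := fun h => cone cB \ox SH h)) //; linearity.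
Qed.

Lemma BH_antipode_pure b h : S (b \ox h) = cone cB \ox SH (PhiB b * h).
Proof. by rewrite BH_antipodeE BH_Phi_pure. Qed.

Lemma BH_lactM g h X : lact (g * h) X = lact g (lact h X).
Proof.
move: X; apply: tensor_ext; try by linearity.
move=> b k; rewrite !BH_lact_pure (hopf_comulM hH) tsum_tsum; last by linearity.
rewrite (lin_tsum _ _ (lL.2 g)).
under [RHS]eq_tsum => h1 h2 do rewrite BH_lact_pure.
rewrite tsum_exchange; apply: eq_tsum => g1 g2.
rewrite tsum_pures; last by linearity.
by apply: eq_tsum => h1 h2; rewrite (arb_actM hR) mulrA.
Qed.

(** [g1 * h * S g2 * g3 * k], in which [S g2 * g3] collapses by the antipode
    axiom. *)
Lemma adjoint_mul g h k :
  \tsum_(g1, g2 <- comul cH g) (ad cH SH g1 h * (g2 * k)) = g * h * k.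
Proof.
rewrite /ad.
transitivity (\tsum_(u, g3 <- comul cH g) \tsum_(g1, g2 <- comul cH u)
  (g1 * h * (SH g2 * g3) * k)).
  apply: eq_tsum => u g3; rewrite (lin_tsum _ _ (g := fun x => x * (g3 * k)));
    last by linearity.
  by apply: eq_tsum => g1 g2; rewrite !mulrA.
rewrite (sweedlerA hcH); last by linearity.
rewrite -[RHS](sweedler_counitr hcH g (f := fun x => x * h * k));
  last by linearity.
apply: eq_tsum => g1 v.
rewrite -(lin_tsum _ _ (g := fun x => g1 * h * x * k)); last by linearity.
by rewrite (antipodel hH) -scalerAr mulr1 -scalerAl.
Qed.

Lemma BH_Phi_lact g X : Phi (lact g X) = g * Phi X.
Proof.
move: X; apply: tensor_ext; try by linearity.
move=> b k; rewrite BH_lact_pure BH_Phi_pure (lin_tsum _ _ PL) mulrA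
  -adjoint_mul.
by apply: eq_tsum => g1 g2; rewrite BH_Phi_pure (arb_Phi_act hR).
Qed.

Lemma BH_augmented_dialgebra : is_augmented_dialgebra Phi lact ract.
Proof.
split.
- exact: bilinP.
- exact: bilinP.
- apply: tensor_ext; try by linearity.
  move=> b h; rewrite BH_lact_pure (comul1 hH) tsumP; last by linearity.
  by rewrite (arb_act1 hR) mul1r.
- exact: BH_lactM.
- apply: tensor_ext; try by linearity.
  by move=> b h; rewrite BH_ract_pure mulr1.
- move=> X g h; move: X; apply: tensor_ext; try by linearity.
  by move=> b k; rewrite !BH_ract_pure mulrA.
- move=> g X h; move: X; apply: tensor_ext; try by linearity.
  move=> b k; rewrite BH_ract_pure !BH_lact_pure (lin_tsum _ _ (rL.1 h)).
  by apply: eq_tsum => g1 g2; rewrite BH_ract_pure mulrA.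
- exact: BH_Phi_lin.
- exact: BH_Phi_lact.
- move=> X h; move: X; apply: tensor_ext; try by linearity.
  by move=> b k; rewrite BH_ract_pure !BH_Phi_pure mulrA.
Qed.

Lemma BH_Phi_c3morphism : is_c3morphism cBH cH Phi.
Proof.
apply: tensor_c3morphism => //; try by linearity.
- move=> b h; rewrite (hopf_comulM hH) (c3mor_sweedler _ PhiM) //; linearity.
- by move=> b h; rewrite (hopf_counitM hH) (c3mor_counit PhiM).
- by rewrite Phi_cone (hopf_cone hH) mulr1.
Qed.

(** The left side produces the factors [g1, g2] of the first leg of [comul g]
    and [g3, g4] of the second; the right side has [g2] and [g3] exchanged, and
    this is where [H] must be cocommutative. *)
Lemma comul_BH_lact g X : comul cBH (lact g X) =
  \tsum_(g1, g2 <- comul cH g) \tsum_(X1, X2 <- comul cBH X)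
    (lact g1 X1 \ox lact g2 X2).
Proof.
move: X; apply: tensor_ext; try by linearity.
move=> b k; rewrite BH_lact_pure (lin_tsum _ _ (lin_comul hBH)).
transitivity (\tsum_(u, v <- comul cH g)
  \tsum_(g1, g2 <- comul cH u) \tsum_(g3, g4 <- comul cH v)
  \tsum_(b1, b2 <- comul cB b) \tsum_(k1, k2 <- comul cH k)
   ((l (g1 \ox b1) \ox (g3 * k1)) \ox (l (g2 \ox b2) \ox (g4 * k2)))).
  apply: eq_tsum => u v; rewrite comul_pure // comul_act tsum_tsum;
    last by linearity.
  apply: eq_tsum => g1 g2; rewrite tsum_pures; last by linearity.
  rewrite [RHS]tsum_exchange; apply: eq_tsum => b1 b2.
  rewrite (hopf_comulM hH) tsum_tsum; last by linearity.
  by apply: eq_tsum => g3 g4; rewrite tsum_pures //; linearity.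
rewrite (sweedler_interchange hcH) //; try by linearity.
apply: eq_tsum => u v; rewrite sweedler_tensor //; last by linearity.
under [RHS]eq_tsum => b1 b2.
  under eq_tsum => k1 k2 do rewrite !BH_lact_pure pure_tsum.
  rewrite tsum_exchange; under eq_tsum => g1 g2 do rewrite tsum_exchange.
  over.
rewrite [RHS]tsum_exchange; apply: eq_tsum => g1 g2.
by rewrite [RHS]tsum_exchange.
Qed.

Lemma counit_BH_lact g X : counit cBH (lact g X) = counit cH g * counit cBH X.
Proof.
have eL := lin_counit hBH.
move: X; apply: (tensor_ext (W := K^o)); first by linearity.
  by apply: (lin_scale (V := K^o)).
move=> b k; rewrite BH_lact_pure (lin_tsum _ _ eL) counit_pure //.
rewrite -[in RHS](counitl hcH g) (lin_tsum _ _ (lin_counit hcH)).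
rewrite (lin_tsum (X := K^o) _ _
  (g := fun x : K^o => x * (counit cB b * counit cH k))).
  apply: eq_tsum => g1 g2; rewrite counit_pure // counit_act (hopf_counitM hH).
  by rewrite (linZ (lin_counit hcH)) -!mulrA; congr (_ * _); rewrite mulrCA.
by move=> a x y; rewrite mulrDl scalerAl.
Qed.

Lemma comul_BH_ract X g : comul cBH (ract X g) =
  \tsum_(X1, X2 <- comul cBH X) \tsum_(g1, g2 <- comul cH g)
    (ract X1 g1 \ox ract X2 g2).
Proof.
move: X; apply: tensor_ext; try by linearity.
move=> b k; rewrite BH_ract_pure sweedler_tensor //; last by linearity.
rewrite comul_pure //; apply: eq_tsum => b1 b2.
rewrite (hopf_comulM hH) tsum_tsum; last by linearity.
apply: eq_tsum => k1 k2; rewrite tsum_pures; last by linearity.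
by apply: eq_tsum => g1 g2; rewrite !BH_ract_pure.
Qed.

Lemma counit_BH_ract X g : counit cBH (ract X g) = counit cBH X * counit cH g.
Proof.
have eL := lin_counit hBH.
move: X; apply: (tensor_ext (W := K^o)); first by linearity.
  by move=> a x y; cbv beta; rewrite (eL a x y) mulrDl; congr (_ + _);
    rewrite -mulrA.
by move=> b k; rewrite BH_ract_pure !counit_pure // (hopf_counitM hH) mulrA.
Qed.

(** On [1 \ox H] the left action is left multiplication, since [H] acts on the
    distinguished element of [B] through the counit. *)
Lemma BH_lact_cone g : lact g (cone cBH) = cone cB \ox g.
Proof.
rewrite /cBH /= (hopf_cone hH) BH_lact_pure.
rewrite -[RHS](sweedler_counitl hcH g (f := fun g => cone cB \ox g));
  last by linearity.
apply: eq_tsum => g1 g2; rewrite (arb_act_cone hR) mulr1.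
by rewrite (linZ ((bilin_pure B H).1 g2)).
Qed.

Lemma BH_Phi_cone : Phi (cone cBH) = 1.
Proof. by rewrite (c3mor_cone BH_Phi_c3morphism) (hopf_cone hH). Qed.

Let PM := BH_Phi_c3morphism.
Let vd := aug_vd Phi lact.
Let dv := aug_dv Phi ract.

Lemma BH_vd_c3morphism : is_c3morphism (tensor_c3 cBH cBH) cBH (tsum vd).
Proof.
have eL := lin_counit hBH.
apply: tensor_c3morphism => //; rewrite /vd /aug_vd; try by linearity.
- by move=> X Y; rewrite comul_BH_lact (c3mor_sweedler _ PM) //; linearity.
- by move=> X Y; rewrite counit_BH_lact (c3mor_counit PM).
- by rewrite BH_lact_cone BH_Phi_cone /cBH /= (hopf_cone hH).
Qed.

Lemma BH_dv_c3morphism : is_c3morphism (tensor_c3 cBH cBH) cBH (tsum dv).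
Proof.
have eL := lin_counit hBH.
apply: tensor_c3morphism => //; rewrite /dv /aug_dv; try by linearity.
- move=> X Y; rewrite comul_BH_ract; apply: eq_tsum => X1 X2.
  by rewrite (c3mor_sweedler _ PM) //; linearity.
- by move=> X Y; rewrite counit_BH_ract (c3mor_counit PM).
- by rewrite BH_Phi_cone (ad_ract1 BH_augmented_dialgebra).
Qed.

Lemma BH_antipode_c3morphism : is_c3morphism cBH cBH S.
Proof.
have := c3mor_comp (c3mor_comp PM (antipode_c3morphism hH cC))
  (inr_c3morphism hB hcH).
by congr is_c3morphism; apply: funext => X; rewrite BH_antipodeE.
Qed.

(** Everything factors through the coalgebra map [Phi], so the identity becomes
    the right antipode identity of [H] for the element [Phi X]. *)
Lemma BH_antipoder X :
  \tsum_(X1, X2 <- comul cBH X) vd X1 (S X2) = counit cBH X *: cone cBH.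
Proof.
rewrite -(c3mor_counit PM) /vd /aug_vd.
under eq_tsum => X1 X2 do rewrite BH_antipodeE BH_lact_pure.
rewrite -(c3mor_sweedler (F := fun g k =>
  \tsum_(g1, g2 <- comul cH g) (l (g1 \ox cone cB) \ox (g2 * SH k))) _ PM);
    last by linearity.
transitivity (\tsum_(g, k <- comul cH (Phi X)) (cone cB \ox (g * SH k))).
  apply: eq_tsum => g k.
  rewrite -[RHS](sweedler_counitl hcH g
    (f := fun g => cone cB \ox (g * SH k))); last by linearity.
  apply: eq_tsum => g1 g2; rewrite (arb_act_cone hR).
  by rewrite (linZ ((bilin_pure B H).1 (g2 * SH k))).
have pL := (bilin_pure B H).2 (cone cB).
by rewrite -(lin_tsum _ _ pL) (antipoder hH) (linZ pL) /cBH /= (hopf_cone hH).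
Qed.

Lemma BH_antipodel X :
  \tsum_(X1, X2 <- comul cBH X) dv (S X1) X2 = counit cBH X *: cone cBH.
Proof.
rewrite -(c3mor_counit PM) /dv /aug_dv.
under eq_tsum => X1 X2 do rewrite BH_antipodeE BH_ract_pure.
rewrite -(c3mor_sweedler (F := fun g k => cone cB \ox (SH g * k)) _ PM);
  last by linearity.
have pL := (bilin_pure B H).2 (cone cB).
by rewrite -(lin_tsum _ _ pL) (antipodel hH) (linZ pL) /cBH /= (hopf_cone hH).
Qed.

Lemma BH_hopf_dialgebra : cocommutative cB ->
  is_augmented_cocommutative_hopf_dialgebra cBH Phi lact ract S.
Proof.
move=> bC; have aD := BH_augmented_dialgebra.
split=> //; split.
- exact: hBH.
- exact: tensor_cocommutative.
- exact: augmented_is_dialgebra.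
- move=> X; split; rewrite /aug_vd /aug_dv BH_Phi_cone.
    exact: (ad_lact1 aD).
  exact: (ad_ract1 aD).
- move=> X; rewrite /aug_vd /aug_dv BH_lact_cone /cBH /= (hopf_cone hH).
  by rewrite BH_ract_pure mul1r.
- exact: BH_vd_c3morphism.
- exact: BH_dv_c3morphism.
- exact: BH_antipode_c3morphism.
- exact: BH_antipoder.
- exact: BH_antipodel.
Qed.
End TensorHopfDialgebra.

(** * Primitive elements *)

Section Primitive.
Variables (K : comNzRingType) (C : lmodType K) (c : c3struct C).
Hypothesis hc : is_c3coalgebra c.

Lemma sweedler_prim (V : lmodType K) (F : C -> C -> V) x : bilin F ->
  Prim c x ->
  \tsum_(x1, x2 <- comul c x) F x1 x2 = F x (cone c) + F (cone c) x.
Proof.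
by move=> FL ->; rewrite (linD (tsum_linear (bilinP FL))) !tsumP.
Qed.

(** The counit law for [x] reads [counit x *: 1 + x = x]. *)
Lemma Prim_counit x : Prim c x -> counit c x = 0.
Proof.
move=> xP; have eL := lin_counit hc.
have := counitl hc x; rewrite sweedler_prim //; last by linearity.
rewrite (counit_cone hc) scale1r -[RHS]add0r => /addIr /(congr1 (counit c)).
by rewrite (linZ eL) (counit_cone hc) (lin0 eL) => <-; rewrite [RHS]mulr1.
Qed.

Lemma Prim_submodule : submodule (Prim c).
Proof.
have DL := lin_comul hc; split=> [|a x y xP yP]; rewrite /Prim /=.
  by rewrite (lin0 DL) (lin0 ((bilin_pure C C).1 _))
    (lin0 ((bilin_pure C C).2 _)) addr0.
rewrite (DL a) xP yP scalerDr addrACA.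
by rewrite ((bilin_pure C C).1 _ a) ((bilin_pure C C).2 _ a).
Qed.

Lemma Prim_morphism (D : lmodType K) (d : c3struct D) f x :
  is_c3morphism c d f -> Prim c x -> Prim d (f x).
Proof.
move=> fM xP; rewrite /Prim /= (c3mor_comul fM) /tensor_map sweedler_prim //.
  by rewrite (c3mor_cone fM).
by linearity.
Qed.
End Primitive.

Section SubmoduleFacts.
Variables (K : comNzRingType) (V : lmodType K) (A : set V).
Hypothesis hA : submodule A.

Lemma submodule0 : A 0. Proof. exact: hA.1. Qed.

Lemma submoduleD x y : A x -> A y -> A (x + y).
Proof. by move=> xA yA; rewrite -[x]scale1r; apply: hA.2. Qed.

Lemma submoduleN x : A x -> A (- x).
Proof.
by move=> xA; rewrite -scaleN1r -[_ *: _]addr0; apply: hA.2 => //; apply: hA.1.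
Qed.

Lemma submodule_image (W : lmodType K) (f : V -> W) :
  islin f -> submodule [set f x | x in A].
Proof.
move=> fL; split=> [|a _ _ [x xA <-] [y yA <-]].
  by exists 0; [exact: hA.1|exact: lin0].
by exists (a *: x + y); [exact: hA.2|exact: fL].
Qed.
End SubmoduleFacts.

Section PrimTensor.
Variables (K : comNzRingType) (C D : lmodType K) (c : c3struct C)
  (d : c3struct D).
Hypotheses (hc : is_c3coalgebra c) (hd : is_c3coalgebra d).
Let cd := tensor_c3 c d.
Let hcd : is_c3coalgebra cd := tensor_c3coalgebra hc hd.

Definition tensor_fst (X : tensor C D) : C :=
  \tsum_(x, y <- X) (counit d y *: x).
Definition tensor_snd (X : tensor C D) : D :=
  \tsum_(x, y <- X) (counit c x *: y).

Lemma tensor_fst_pure x y : tensor_fst (x \ox y) = counit d y *: x.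
Proof. by rewrite /tensor_fst tsumP //; linearity. Qed.

Lemma tensor_snd_pure x y : tensor_snd (x \ox y) = counit c x *: y.
Proof. by rewrite /tensor_snd tsumP //; linearity. Qed.

Lemma tensor_fst_c3morphism : is_c3morphism cd c tensor_fst.
Proof.
apply: tensor_c3morphism => //; try by linearity.
- move=> x y; rewrite (linZ (lin_comul hc)).
  transitivity (\tsum_(x1, x2 <- comul c x) (counit d y *: (x1 \ox x2))).
    by rewrite -(lin_tsum _ _ (g := fun t => counit d y *: t)) ?tsum_puresE //;
      linearity.
  apply: eq_tsum => x1 x2.
  rewrite -(sweedler_counitl hd y (f := fun y => counit d y *: (x1 \ox x2)));
    last by linearity.
  apply: eq_tsum => y1 y2; rewrite (linZ ((bilin_pure C C).1 _)).
  by rewrite (linZ ((bilin_pure C C).2 _)).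
- by move=> x y; rewrite (linZ (lin_counit hc)) [LHS]mulrC.
- by rewrite (counit_cone hd) scale1r.
Qed.

Lemma tensor_snd_c3morphism : is_c3morphism cd d tensor_snd.
Proof.
apply: tensor_c3morphism => //; try by linearity.
- move=> x y; rewrite (linZ (lin_comul hd)) tsum_exchange.
  transitivity (\tsum_(y1, y2 <- comul d y) (counit c x *: (y1 \ox y2))).
    by rewrite -(lin_tsum _ _ (g := fun t => counit c x *: t)) ?tsum_puresE //;
      linearity.
  apply: eq_tsum => y1 y2.
  rewrite -(sweedler_counitl hc x (f := fun x => counit c x *: (y1 \ox y2)));
    last by linearity.
  apply: eq_tsum => x1 x2; rewrite (linZ ((bilin_pure D D).1 _)).
  by rewrite (linZ ((bilin_pure D D).2 _)).
- by move=> x y; rewrite (linZ (lin_counit hd)).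
- by rewrite (counit_cone hc) scale1r.
Qed.

Let pM := tensor_fst_c3morphism.
Let qM := tensor_snd_c3morphism.

(** Collapsing the second leg of the [x]-factor and the first leg of the
    [y]-factor by the counits. *)
Lemma tensor_fst_snd X :
  \tsum_(X1, X2 <- comul cd X) (tensor_fst X1 \ox tensor_snd X2) = X.
Proof.
move: X; apply: tensor_ext; [by linearity|exact: lin_id|move=> x y].
rewrite sweedler_tensor //; last by linearity.
rewrite -[RHS](sweedler_counitr hc x (f := fun x => x \ox y));
  last by linearity.
apply: eq_tsum => x1 x2.
rewrite -(sweedler_counitl hd y (f := fun y => x1 \ox y)); last by linearity.
rewrite (lin_tsum _ _ (g := fun t => counit c x2 *: t)); last by linearity.
apply: eq_tsum => y1 y2; rewrite tensor_fst_pure tensor_snd_pure.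
by rewrite (linZ ((bilin_pure C D).1 _)) (linZ ((bilin_pure C D).2 _)) scalerA
  mulrC -scalerA.
Qed.

(** Evaluate [tensor_fst_snd] with the primitive form of [comul X]. *)
Lemma Prim_tensorE X : Prim cd X ->
  X = tensor_fst X \ox cone d + cone c \ox tensor_snd X.
Proof.
move=> XP; rewrite -[LHS]tensor_fst_snd sweedler_prim //; last by linearity.
by rewrite (c3mor_cone pM) (c3mor_cone qM).
Qed.

Lemma Prim_tensor_fst x y : Prim d y ->
  tensor_fst (x \ox cone d + cone c \ox y) = x.
Proof.
move=> yP; rewrite (linD (lin_c3mor pM)) !tensor_fst_pure.
by rewrite (counit_cone hd) (Prim_counit hd yP) scale1r scale0r addr0.
Qed.

Lemma Prim_tensor_snd x y : Prim c x ->
  tensor_snd (x \ox cone d + cone c \ox y) = y.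
Proof.
move=> xP; rewrite (linD (lin_c3mor qM)) !tensor_snd_pure.
by rewrite (counit_cone hc) (Prim_counit hc xP) scale1r scale0r add0r.
Qed.

Lemma Prim_tensor x y : Prim c x -> Prim d y ->
  Prim cd (x \ox cone d + cone c \ox y).
Proof.
move=> xP yP; apply: (submoduleD (Prim_submodule hcd)).
  exact: Prim_morphism (inl_c3morphism hc hd) xP.
exact: Prim_morphism (inr_c3morphism hc hd) yP.
Qed.

Lemma Prim_tensor_bij :
  set_bij (Prim c `*` Prim d) (Prim cd)
    (fun p : C * D => p.1 \ox cone d + cone c \ox p.2).
Proof.
split=> [[x y] [/= xP yP]|[x y] [x' y']|X XP].
- exact: Prim_tensor.
- rewrite !inE => -[/= xP yP] [/= xP' yP'] e; congr (_, _).
    by rewrite -(Prim_tensor_fst x yP) e Prim_tensor_fst.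
  by rewrite -(Prim_tensor_snd y xP) e Prim_tensor_snd.
- exists (tensor_fst X, tensor_snd X); last by rewrite [RHS]Prim_tensorE.
  by split; [exact: Prim_morphism pM XP|exact: Prim_morphism qM XP].
Qed.
End PrimTensor.

Section PrimHopf.
Variables (K : comNzRingType) (H : algType K) (c : c3struct H) (S : H -> H).
Hypothesis hH : is_hopf_algebra c S.
Let hc : is_c3coalgebra c := hopf_c3 hH.

Lemma sweedler_prim_hopf (V : lmodType K) (F : H -> H -> V) x : bilin F ->
  Prim c x ->
  \tsum_(x1, x2 <- comul c x) F x1 x2 = F x 1 + F 1 x.
Proof. by move=> FL xP; rewrite sweedler_prim // (hopf_cone hH). Qed.

Lemma Prim_antipode x : Prim c x -> S x = - x.
Proof.
move=> xP; apply/eqP; rewrite -addr_eq0; have := antipodel hH x.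
rewrite sweedler_prim_hopf //; last by linearity.
by rewrite mulr1 (antipode1 hH) mul1r (Prim_counit hc xP) scale0r => ->.
Qed.

Lemma Prim_ad x h : Prim c x -> ad c S x h = commutator x h.
Proof.
move=> xP; rewrite /ad sweedler_prim_hopf //; last by linearity.
by rewrite (antipode1 hH) Prim_antipode // mulr1 mul1r mulrN.
Qed.

(** The mixed terms [x \ox y] and [y \ox x] in the comultiplication of [x * y]
    are symmetric in [x] and [y], so they cancel in the commutator. *)
Lemma Prim_commutator x y : Prim c x -> Prim c y -> Prim c (commutator x y).
Proof.
have mL := bilin_mul H.
have comulM u v : Prim c u -> Prim c v ->
    comul c (u * v) = (u * v) \ox 1 + u \ox v + (v \ox u + 1 \ox (u * v)).
  move=> uP vP; rewrite (hopf_comulM hH) sweedler_prim_hopf //;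
    last by linearity.
  rewrite !sweedler_prim_hopf //; try by linearity.
  by rewrite !(mulr1, mul1r).
move=> xP yP; rewrite /Prim /= /commutator (linB (lin_comul hc)) !comulM //.
rewrite (hopf_cone hH).
rewrite (linB ((bilin_pure H H).1 _)) (linB ((bilin_pure H H).2 _)).
set b := x \ox y; set b' := y \ox x.
rewrite [_ + b + _]addrACA opprD [LHS]addrACA.
rewrite [- (_ + b')]opprD [- (b + _)]opprD.
by rewrite [_ + b' + _]addrACA [b + _ + _]addrACA !subrr addr0 add0r.
Qed.
End PrimHopf.

(** * The Leibniz algebra of primitive elements *)

Section PrimLeibniz.
Variables (K : comNzRingType) (B : lmodType K) (H : algType K).
Variables (cB : c3struct B) (cH : c3struct H).
Variables (SH : H -> H) (PhiB : B -> H) (l : tensor H B -> B).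
Hypothesis hR : is_augmented_rack_bialgebra cB PhiB cH SH l.

Let hB : is_c3coalgebra cB := arb_c3 hR.
Let hH : is_hopf_algebra cH SH := arb_hopf hR.
Let hcH : is_c3coalgebra cH := hopf_c3 hH.
Let PhiM : is_c3morphism cB cH PhiB := arb_Phi hR.
Let actL : islin l := lin_c3mor (arb_act hR).

Let cBH := tensor_c3 cB cH.
Let hBH : is_c3coalgebra cBH := tensor_c3coalgebra hB hcH.
Let Phi : tensor B H -> H := BH_Phi PhiB.
Let lact := BH_lact cH l.
Let ract : tensor B H -> H -> tensor B H := @BH_ract K B H.
Let br X Y := aug_vd Phi lact X Y - aug_dv Phi ract Y X.
Let a := Prim cBH.
Let PrimH := [set cone cB \ox xi | xi in Prim cH].
Let I := [set x \ox 1 - cone cB \ox PhiB x | x in Prim cB].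
Let inc x xi : tensor B H := x \ox 1 + cone cB \ox xi.

Let brL : bilin br.
Proof.
apply: dialgebra_bracket_bilin;
  exact: (augmented_is_dialgebra (BH_augmented_dialgebra hR)).
Qed.

Let rL (b : B) : islin (fun h : H => b \ox h) := (bilin_pure B H).2 b.
Let lL (h : H) : islin (fun b : B => b \ox h) := (bilin_pure B H).1 h.

Lemma Prim_act p b : Prim cH p -> Prim cB b -> Prim cB (l (p \ox b)).
Proof.
move=> pP bP; rewrite /Prim /= (comul_act hR) (sweedler_prim_hopf hH) //;
  last by linearity.
rewrite !sweedler_prim //; try by linearity.
rewrite !(arb_act1 hR) (arb_act_cone hR) (Prim_counit hcH pP) scale0r.
by rewrite (lin0 ((bilin_pure B B).1 _)) (lin0 ((bilin_pure B B).2 _)) addr0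
  add0r.
Qed.

Lemma Prim_rack_op x y : Prim cB x -> Prim cB y -> Prim cB (rack_op PhiB l x y).
Proof.
by move=> xP yP; apply: Prim_act => //; apply: Prim_morphism PhiM xP.
Qed.

Lemma BH_lact_prim p b h : Prim cH p ->
  lact p (b \ox h) = l (p \ox b) \ox h + b \ox (p * h).
Proof.
move=> pP; rewrite /lact (BH_lact_pure hR) (sweedler_prim_hopf hH) //;
  last by linearity.
by rewrite (arb_act1 hR) mul1r.
Qed.

Lemma BH_Phi_inc x xi : Phi (inc x xi) = PhiB x + xi.
Proof.
rewrite /Phi /inc (linD (BH_Phi_lin hR)) !(BH_Phi_pure hR) (Phi_cone hR).
by rewrite mulr1 mul1r.
Qed.

(** With [p = Phi X] primitive, [X |- Y = p.Y] and [Y -| X = Y.p] share the term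
    [y \ox p], which cancels; the rest is [p.y \ox 1] and the commutator of [p]
    with [eta]. *)
Lemma BH_bracket x y xi eta :
  Prim cB x -> Prim cB y -> Prim cH xi -> Prim cH eta ->
  br (inc x xi) (inc y eta) =
  inc (rack_op PhiB l x y + l (xi \ox y))
    (commutator (PhiB x) eta + commutator xi eta).
Proof.
move=> xP yP xiP etaP; rewrite /br /aug_vd /aug_dv BH_Phi_inc.
set p := PhiB x + xi.
have pP : Prim cH p.
  by apply: (submoduleD (Prim_submodule hcH)) => //;
    apply: Prim_morphism PhiM xP.
rewrite /inc /lact /ract.
rewrite (linD ((BH_lact_bilin hR).2 p)) (linD ((BH_ract_bilin B H).1 p)).
rewrite -/lact !BH_lact_prim // !BH_ract_pure.
rewrite (arb_act_cone hR) (Prim_counit hcH pP).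
rewrite scale0r (lin0 (lL eta)) add0r mulr1 mul1r opprD [LHS]addrACA addrK.
have -> : rack_op PhiB l x y + l (xi \ox y) = l (p \ox y).
  by rewrite /p (linD ((bilin_pure H B).1 y)) (linD actL).
rewrite -(linB (rL _)); congr (_ + _ \ox _).
by rewrite /commutator /p mulrDl mulrDr opprD addrACA.
Qed.

Lemma Prim_bracket_components x y xi eta :
  Prim cB x -> Prim cB y -> Prim cH xi -> Prim cH eta ->
  Prim cB (rack_op PhiB l x y + l (xi \ox y)) /\
  Prim cH (commutator (PhiB x) eta + commutator xi eta).
Proof.
move=> xP yP xiP etaP; split.
  apply: (submoduleD (Prim_submodule hB)); first exact: Prim_rack_op.
  exact: Prim_act.
apply: (submoduleD (Prim_submodule hcH)); apply: (Prim_commutator hH) => //.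
exact: Prim_morphism PhiM xP.
Qed.

Lemma Prim_BH_bij : set_bij (Prim cB `*` Prim cH) a
  (fun p : B * H => inc p.1 p.2).
Proof. by rewrite /inc -(hopf_cone hH); apply: Prim_tensor_bij. Qed.

Lemma Prim_BH_inc x xi : Prim cB x -> Prim cH xi -> a (inc x xi).
Proof.
by move=> xP xiP; have [sub _ _] := Prim_BH_bij; exact: (sub (x, xi)).
Qed.

Lemma Prim_BHP X : a X ->
  exists x xi, [/\ Prim cB x, Prim cH xi & X = inc x xi].
Proof.
by have [_ _ surj] := Prim_BH_bij; move=> /surj [[x xi] [/= xP xiP] <-];
  exists x, xi.
Qed.

Lemma Prim_BH_inj x xi y eta : Prim cB x -> Prim cH xi -> Prim cB y ->
  Prim cH eta -> inc x xi = inc y eta -> x = y /\ xi = eta.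
Proof.
move=> xP xiP yP etaP e; have [_ inj _] := Prim_BH_bij.
by suff [-> ->] : (x, xi) = (y, eta) by []; apply: inj; rewrite ?inE.
Qed.

(** Bilinearity and the Leibniz identity hold on all of [B \ox H]; only closure
    is specific to the primitives, and there the bracket formula shows it. *)
Lemma Prim_BH_leibniz : is_leibniz_algebra br a.
Proof.
split.
- exact: Prim_submodule.
- move=> _ _ /Prim_BHP [x [xi [xP xiP ->]]] /Prim_BHP [y [eta [yP etaP ->]]].
  rewrite BH_bracket //; have [] := Prim_bracket_components xP yP xiP etaP.
  exact: Prim_BH_inc.
- by move=> k X Y Z _ _ _; apply: brL.1.
- by move=> k X Y Z _ _ _; apply: brL.2.
- move=> X Y Z _ _ _; apply: dialgebra_bracket_leibniz.
  exact: augmented_is_dialgebra (BH_augmented_dialgebra hR).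
Qed.

Let inc0 xi : inc 0 xi = cone cB \ox xi.
Proof. by rewrite /inc (lin0 (lL 1)) add0r. Qed.

Let incN x : inc x (- PhiB x) = x \ox 1 - cone cB \ox PhiB x.
Proof. by rewrite /inc (linN (rL _)). Qed.

Let PhiP x : Prim cB x -> Prim cH (PhiB x) := Prim_morphism PhiM.
Let NPhiP x : Prim cB x -> Prim cH (- PhiB x).
Proof. by move=> xP; apply: (submoduleN (Prim_submodule hcH)); apply: PhiP. Qed.
Let P0 : Prim cB 0 := submodule0 (Prim_submodule hB).

Let PrimHE : PrimH = [set inc 0 xi | xi in Prim cH].
Proof. by congr image; apply: funext => xi; rewrite inc0. Qed.

Let IE : I = [set inc x (- PhiB x) | x in Prim cB].
Proof. by congr image; apply: funext => x; rewrite incN. Qed.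

Lemma bracket_PrimH xi eta : Prim cH xi -> Prim cH eta ->
  br (inc 0 xi) (inc 0 eta) = inc 0 (commutator xi eta).
Proof.
move=> xiP etaP; rewrite BH_bracket // /rack_op (lin0 (lin_c3mor PhiM)).
rewrite !(lin0 ((bilin_pure H B).1 _), lin0 ((bilin_pure H B).2 _)).
rewrite !(lin0 actL).
by rewrite /commutator mul0r mulr0 subrr !add0r.
Qed.

Lemma PrimH_sub : PrimH `<=` a.
Proof. by rewrite PrimHE => _ [xi xiP <-]; apply: Prim_BH_inc. Qed.

Lemma PrimH_submodule : submodule PrimH.
Proof. by apply: submodule_image (rL _); apply: Prim_submodule. Qed.

Lemma PrimH_lie : is_lie_subalgebra br a PrimH.
Proof.
have leib := Prim_BH_leibniz; split; first exact: PrimH_sub.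
  split.
  - exact: PrimH_submodule.
  - rewrite PrimHE => _ _ [xi xiP <-] [eta etaP <-]; rewrite bracket_PrimH //.
    by exists (commutator xi eta) => //; apply: (Prim_commutator hH).
  - move=> k X Y Z /PrimH_sub XP /PrimH_sub YP /PrimH_sub ZP.
    by apply: (leib_linearl leib).
  - move=> k X Y Z /PrimH_sub XP /PrimH_sub YP /PrimH_sub ZP.
    by apply: (leib_linearr leib).
  - move=> X Y Z /PrimH_sub XP /PrimH_sub YP /PrimH_sub ZP.
    by apply: (leib_identity leib).
rewrite PrimHE => _ [xi xiP <-]; rewrite bracket_PrimH // /commutator subrr.
by rewrite inc0 (lin0 (rL _)).
Qed.

(** Both products in [br Z X] act through [Phi Z]. *)
Lemma bracket_kernel Z X : Phi Z = 0 -> br Z X = 0.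
Proof.
move=> Z0; rewrite /br /aug_vd /aug_dv Z0.
rewrite /lact /ract (lin0 ((BH_lact_bilin hR).1 X)).
by rewrite (lin0 ((BH_ract_bilin B H).2 X)) subrr.
Qed.

Lemma I_left_center : I `<=` left_center br a.
Proof.
rewrite IE => _ [x xP <-]; split.
  by apply: Prim_BH_inc => //; apply: NPhiP.
by move=> X _; apply: bracket_kernel; rewrite BH_Phi_inc subrr.
Qed.

Lemma I_submodule : submodule I.
Proof.
apply: submodule_image; first exact: Prim_submodule.
by have PL := lin_c3mor PhiM; linearity.
Qed.

(** The bracket [y + eta, x - PhiB x] has components [p.x] and
    [- commutator p (PhiB x)] for [p = PhiB y + eta], and [PhiB (p.x)] is that
    commutator because [ad] by a primitive element is the commutator.  In the
    other order the bracket vanishes. *)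
Lemma I_ideal : is_two_sided_ideal br a I.
Proof.
split.
- by move=> X /I_left_center [].
- exact: I_submodule.
- rewrite IE => X _ /Prim_BHP [y [eta [yP etaP ->]]] [x xP <-].
  rewrite BH_bracket //; last exact: NPhiP.
  have [zP _] := Prim_bracket_components yP xP etaP etaP.
  exists (rack_op PhiB l y x + l (eta \ox x)) => //; congr inc.
  rewrite (linD (lin_c3mor PhiM)) /rack_op !(arb_Phi_act hR) !(Prim_ad hH) //;
    last exact: PhiP.
  by rewrite opprD /commutator !(mulrN, mulNr) !opprD.
- move=> X Z XP /I_left_center [_ ->] //.
  exact: submodule0 I_submodule.
Qed.

(** [x + xi = (xi + PhiB x) + (x - PhiB x)]. *)
Lemma Prim_BH_split : direct_sum a PrimH I.
Proof.
have aS : submodule a := Prim_submodule hBH.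
split; [exact: PrimH_submodule|exact: I_submodule| |].
  move=> X; split; last first.
    move=> [U [V [/PrimH_sub UP /I_left_center [VP _] ->]]].
    exact: submoduleD.
  move=> /Prim_BHP [x [xi [xP xiP ->]]].
  exists (cone cB \ox (xi + PhiB x)), (x \ox 1 - cone cB \ox PhiB x).
  split; [exists (xi + PhiB x) => //|by exists x|].
    by apply: (submoduleD (Prim_submodule hcH)) => //; apply: PhiP.
  by rewrite (linD (rL _)) addrACA subrr addr0 addrC.
rewrite PrimHE IE => _ [xi xiP <-] [x xP].
case/(Prim_BH_inj xP (NPhiP xP) P0 xiP) => -> <-.
by rewrite (lin0 (lin_c3mor PhiM)) oppr0 inc0 (lin0 (rL _)).
Qed.
End PrimLeibniz.

Theorem theorem2p6 (K : comNzRingType) (iota : {rmorphism rat -> K})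
    (B : lmodType K) (H : algType K) (cB : c3struct B) (cH : c3struct H)
    (SH : H -> H) (PhiB : B -> H) (l : tensor H B -> B) :
  is_augmented_rack_bialgebra cB PhiB cH SH l ->
  cocommutative cB ->
  let cBH := tensor_c3 cB cH in
  let Phi := BH_Phi PhiB in
  let lact := BH_lact cH l in
  let ract := @BH_ract K B H in
  let S := BH_antipode cB SH PhiB in
  let br X Y := aug_vd Phi lact X Y - aug_dv Phi ract Y X in
  let a := Prim cBH in
  let PrimH := [set cone cB \ox xi | xi in Prim cH] in
  let I := [set x \ox 1 - cone cB \ox PhiB x | x in Prim cB] in
  [/\ forall b h, Phi (b \ox h) = PhiB b * h,
      forall h' b h, lact h' (b \ox h) =
        \tsum_(h1, h2 <- comul cH h') (l (h1 \ox b) \ox (h2 * h)),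
      forall b h h', ract (b \ox h) h' = b \ox (h * h'),
      forall b h, S (b \ox h) = cone cB \ox SH (PhiB b * h) &
      is_augmented_cocommutative_hopf_dialgebra cBH Phi lact ract S]
  /\
  [/\ set_bij (Prim cB `*` Prim cH) a
        (fun p : B * H => p.1 \ox 1 + cone cB \ox p.2),
      is_leibniz_algebra br a &
      forall x y xi eta, Prim cB x -> Prim cB y -> Prim cH xi -> Prim cH eta ->
        [/\ Prim cB (rack_op PhiB l x y + l (xi \ox y)),
            Prim cH (commutator (PhiB x) eta + commutator xi eta) &
            br (x \ox 1 + cone cB \ox xi) (y \ox 1 + cone cB \ox eta) =
              (rack_op PhiB l x y + l (xi \ox y)) \ox 1 +
              cone cB \ox (commutator (PhiB x) eta + commutator xi eta)]]
  /\
  [/\ is_lie_subalgebra br a PrimH,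
      is_two_sided_ideal br a I,
      direct_sum a PrimH I &
      I `<=` left_center br a].
Proof.
move=> hR bC cBH Phi lact ract S br a PrimH I; split; last split.
- split.
  + exact: BH_Phi_pure hR.
  + exact: BH_lact_pure hR.
  + exact: BH_ract_pure.
  + exact: BH_antipode_pure hR.
  + exact: BH_hopf_dialgebra hR bC.
- split.
  + exact: Prim_BH_bij hR.
  + exact: Prim_BH_leibniz hR.
  + move=> x y xi eta xP yP xiP etaP.
    have [zP zetaP] := Prim_bracket_components hR xP yP xiP etaP.
    by split=> //; apply: BH_bracket hR _ _ _ _ xP yP xiP etaP.
- split.
  + exact: PrimH_lie hR.
  + exact: I_ideal hR.
  + exact: Prim_BH_split hR.
  + exact: I_left_center hR.
Qed.
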